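(* Suppose $\mathcal L$ is convex-concave over $\mathcal X\times\mathcal Y$. Let $\{x_t,y_t\}_{t\ge 0}$ be the sequence generated by the LMO-LMO algorithm (described in the context) with $\tau_t=(t+1)^{-a}$ and $\beta_t=C(t+1)^{-b}$ (where $C>0$ is any constant), or $\beta_t=0$ where indicated. The following hold for every $T\ge1$, with constants hidden in $O(\cdot)$, $\widetilde O(\cdot)$ independent of $T$. (i) (Convex-concave.) If the standing assumption holds and $a=1$, $b=\frac15$, then $$G^{\mathrm{Opt}}_{\mathcal X}(x_T)\le O(T^{-1/5}),\qquad G_{\mathcal Y}(x_T,y_T)\le O(T^{-1/5}).$$ (ii) (Convex-strongly concave.) If the standing assumption holds with $\mu>0$, and $a=1$, $\beta_t=0$ for all $t$, then $$G^{\mathrm{Opt}}_{\mathcal X}(x_T)\le \widetilde O(T^{-1/3}),\qquad G_{\mathcal Y}(x_T,y_T)\le O(T^{-2/3}).$$ (iii) (Convex-concave, strongly convex $\mathcal Y$.) If the standing assumption holds, $\mathcal Y$ is an $\alpha$-strongly convex set for some $\alpha>0$, and $a=1$, $b=\frac14$, then $$G^{\mathrm{Opt}}_{\mathcal X}(x_T)\le O(T^{-1/4}),\qquad G_{\mathcal Y}(x_T,y_T)\le O(T^{-1/4}).$$ (iv) (Convex-strongly concave, strongly convex $\mathcal Y$.) If the standing assumption holds with $\mu>0$, $\mathcal Y$ is an $\alpha$-strongly convex set for some $\alpha>0$, and $a=1$, $\beta_t=0$ for all $t$, then $$G^{\mathrm{Opt}}_{\mathcal X}(x_T)\le \widetilde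 O(T^{-1/2}),\qquad G_{\mathcal Y}(x_T,y_T)\le O(T^{-1}).$$
   Context: Notation: $\|\cdot\|$ is the Euclidean norm; $\widetilde O$ suppresses factors polynomial in $\log(T+2)$. Standing assumption. $\mathcal X\subset\mathbb R^{d_x}$ and $\mathcal Y\subset\mathbb R^{d_y}$ are nonempty compact convex sets with diameters $D_{\mathcal X}$, $D_{\mathcal Y}$. The payoff $\mathcal L:\mathbb R^{d_x}\times\mathbb R^{d_y}\to\mathbb R$ is continuously differentiable on an open set containing $\mathcal X\times\mathcal Y$; for some $\mu\ge 0$ and every $x\in\mathcal X$, $\mathcal L(x,\cdot)$ is $\mu$-strongly concave on $\mathcal Y$ ($\mu=0$ meaning concave); and there are $L_{xx},L_{yy}\ge 0$, $L_{yx}>0$ such that for all $(x,y),(x',y')\in\mathcal X\times\mathcal Y$, $\|\nabla_x\mathcal L(x,y)-\nabla_x\mathcal L(x',y')\|\le L_{xx}\|x-x'\|+L_{yx}\|y-y'\|$ and $\|\nabla_y\mathcal L(x,y)-\nabla_y\mathcal L(x',y')\|\le L_{yx}\|x-x'\|+L_{yy}\|y-y'\|$. Strongly convex set: $\mathcal Y$ is $\alpha$-strongly convex if for all $y,y'\in\mathcal Y$, $z\in\mathbb R^{d_y}$ with $\|z\|=1$, $\xi\in[0,1]$: $\xi y+(1-\xi)y'+\xi(1-\xi)\frac{\alpha}{2}\|y-y'\|^2z\in\mathcal Y$. Gaps: $f(x)=\max_{y\in\mathcal Y}\mathcal L(x,y)$; $G^{\mathrm{Opt}}_{\mathcal X}(x)=f(x)-\min_{v\in\mathcal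 X}f(v)$; $G_{\mathcal Y}(x,y)=\max_{u\in\mathcal Y}\mathcal L(x,u)-\mathcal L(x,y)$. Linear minimization oracle: $\mathrm{LMO}_{\mathcal U}(d)$ denotes an arbitrary element of $\arg\min_{v\in\mathcal U}d^\top v$. Regularized payoff: $\mathcal L_\beta(x,y)=\mathcal L(x,y)-\frac{\beta}{2}\|y-y_0\|^2$, where $y_0\in\mathcal Y$ is the initial dual iterate. LMO-LMO algorithm: start from $x_0\in\mathcal X$, $y_0\in\mathcal Y$; for $t=0,1,2,\dots$: $v_t=\mathrm{LMO}_{\mathcal X}(\nabla_x\mathcal L(x_t,y_t))$, $x_{t+1}=x_t+\tau_t(v_t-x_t)$; $u_t=\mathrm{LMO}_{\mathcal Y}(-\nabla_y\mathcal L_{\beta_t}(x_t,y_t))$, $\gamma_t=\min\left\{\frac{\nabla_y\mathcal L_{\beta_t}(x_t,y_t)^\top(u_t-y_t)}{(L_{yy}+\beta_t)\|u_t-y_t\|^2},1\right\}$, $y_{t+1}=y_t+\gamma_t(u_t-y_t)$ (if $u_t=y_t$, then $y_{t+1}=y_t$). *)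

(* Defs.v *)
From HB Require Import structures.
From mathcomp Require Import all_boot all_order all_algebra.
From mathcomp Require Import all_classical all_reals all_analysis.

Set Implicit Arguments.
Unset Strict Implicit.
Unset Printing Implicit Defensive.

Import Order.TTheory GRing.Theory Num.Theory.
Import numFieldNormedType.Exports.

Local Open Scope classical_set_scope.
Local Open Scope ring_scope.

Section Euclidean.
Context {R : realType} {d : nat}.
Implicit Types (u v : 'rV[R]_d) (D : set 'rV[R]_d).

Definition dot u v : R := \sum_(i < d) u ord0 i * v ord0 i.

(* The library norm `|v| on row vectors is the sup norm; it induces the same
   topology as the Euclidean norm, but the metric constants differ. *)
Definition enorm v : R := Num.sqrt (dot v v).

Definition grad (f : 'rV[R]_d -> R) (a : 'rV[R]_d) : 'rV[R]_d :=
  \row_(i < d) 'D_(delta_mx ord0 i) f a.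

Definition strongly_concave (mu : R) D (f : 'rV[R]_d -> R) : Prop :=
  forall u v (xi : R), D u -> D v -> 0 <= xi <= 1 ->
    xi * f u + (1 - xi) * f v + mu / 2 * xi * (1 - xi) * enorm (u - v) ^+ 2
      <= f (xi *: u + (1 - xi) *: v).

Definition strongly_convex_set (alpha : R) D : Prop :=
  forall u v z (xi : R), D u -> D v -> enorm z = 1 -> 0 <= xi <= 1 ->
    D (xi *: u + (1 - xi) *: v
       + (xi * (1 - xi) * (alpha / 2) * enorm (u - v) ^+ 2) *: z).

(* [is_lmo D g v]: v is an admissible answer of the oracle LMO_D(g). *)
Definition is_lmo D (g v : 'rV[R]_d) : Prop :=
  D v /\ forall w, D w -> dot g v <= dot g w.

End Euclidean.

Section SaddlePoint.
Context {R : realType} {dx dy : nat}.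
Implicit Types (X : set 'rV[R]_dx) (Y : set 'rV[R]_dy).
Implicit Types (L : 'rV[R]_dx -> 'rV[R]_dy -> R).

Definition gradx L (x : 'rV[R]_dx) (y : 'rV[R]_dy) : 'rV[R]_dx :=
  grad (L^~ y) x.

Definition grady L (x : 'rV[R]_dx) (y : 'rV[R]_dy) : 'rV[R]_dy :=
  grad (L x) y.

Definition continuously_differentiable_on
    (U : set ('rV[R]_dx * 'rV[R]_dy)) L : Prop :=
  forall p, U p ->
    [/\ differentiable (fun q : 'rV[R]_dx * 'rV[R]_dy => L q.1 q.2) p,
        {for p, continuous (fun q => gradx L q.1 q.2)} &
        {for p, continuous (fun q => grady L q.1 q.2)}].

Definition convex_concave X Y L : Prop :=
  (forall y, Y y -> convex_function X (L^~ y)) /\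
  (forall x, X x -> convex_function Y (fun y => - L x y)).

Record standing_assumption X Y L (mu Lxx Lyy Lyx : R) : Prop := {
  sa_X_nonempty : X !=set0;
  sa_X_compact : compact X;
  sa_X_convex : convex_set X;
  sa_Y_nonempty : Y !=set0;
  sa_Y_compact : compact Y;
  sa_Y_convex : convex_set Y;
  sa_C1 : exists U : set ('rV[R]_dx * 'rV[R]_dy),
    [/\ open U, X `*` Y `<=` U & continuously_differentiable_on U L];
  sa_mu_ge0 : 0 <= mu;
  sa_strongly_concave : forall x, X x -> strongly_concave mu Y (L x);
  sa_Lxx_ge0 : 0 <= Lxx;
  sa_Lyy_ge0 : 0 <= Lyy;
  sa_Lyx_gt0 : 0 < Lyx;
  sa_gradx_lipschitz : forall x x' y y', X x -> Y y -> X x' -> Y y' ->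
    enorm (gradx L x y - gradx L x' y')
      <= Lxx * enorm (x - x') + Lyx * enorm (y - y');
  sa_grady_lipschitz : forall x x' y y', X x -> Y y -> X x' -> Y y' ->
    enorm (grady L x y - grady L x' y')
      <= Lyx * enorm (x - x') + Lyy * enorm (y - y')
}.

(* Under the standing assumption the maxima and the minimum below are
   attained, so that they coincide with [sup] and [inf]. *)
Definition primal_fun Y L (x : 'rV[R]_dx) : R := sup [set L x y | y in Y].

Definition gap_opt X Y L (x : 'rV[R]_dx) : R :=
  primal_fun Y L x - inf [set primal_fun Y L v | v in X].

Definition gap_dual Y L (x : 'rV[R]_dx) (y : 'rV[R]_dy) : R :=
  sup [set L x u | u in Y] - L x y.

Definition regularized L (y0 : 'rV[R]_dy) (beta : R) x y : R :=
  L x y - beta / 2 * enorm (y - y0) ^+ 2.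

(* When u = y the quotient is 0 / 0 = 0, and the dual update leaves y
   unchanged, as required. *)
Definition dual_step (Lyy beta : R) (g u y : 'rV[R]_dy) : R :=
  Num.min (dot g (u - y) / ((Lyy + beta) * enorm (u - y) ^+ 2)) 1.

(* The oracle answers v_t and u_t are arbitrary minimizers, chosen anew at
   each iteration. *)
Definition lmo_lmo X Y L (Lyy : R) (tau beta : nat -> R)
    (x : nat -> 'rV[R]_dx) (y : nat -> 'rV[R]_dy) : Prop :=
  [/\ X (x 0%N), Y (y 0%N) &
    forall t, exists v u,
      let g := grady (regularized L (y 0%N) (beta t)) (x t) (y t) in
      [/\ is_lmo X (gradx L (x t) (y t)) v,
          x t.+1 = x t + tau t *: (v - x t),
          is_lmo Y (- g) u &
          y t.+1 = y t + dual_step Lyy (beta t) g u (y t) *: (u - y t)]].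

End SaddlePoint.

Section Rates.
Context {R : realType}.

Definition poly_decay (a : R) (t : nat) : R := t.+1%:R `^ (- a).

(* Non-asymptotic O: the bound holds for every T >= 1. *)
Definition bigO_all (g h : nat -> R) : Prop :=
  exists2 K : R, 0 < K & forall T, (1 <= T)%N -> g T <= K * h T.

Definition bigOtilde_all (g h : nat -> R) : Prop :=
  exists p : nat, bigO_all g (fun T => ln (T%:R + 2) ^+ p * h T).

End Rates.

(* Main.v *)
From HB Require Import structures.
Require Import Defs.
From mathcomp Require Import all_boot all_order all_algebra.
From mathcomp Require Import all_classical all_reals all_analysis.
From mathcomp Require Import ring lra.

Set Implicit Arguments.
Unset Strict Implicit.
Unset Printing Implicit Defensive.

Import Order.TTheory GRing.Theory Num.Theory.
Import numFieldNormedType.Exports.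

Local Open Scope classical_set_scope.
Local Open Scope ring_scope.
Local Open Scope convex_scope.

(**
  Write [h_t] for the dual gap of the regularized payoff at [(x_t, y_t)],
  [sigma_t = mu + beta_t] for the modulus of strong concavity, and [n = t + 1].
  The proof is a two-step bookkeeping of [h_t], followed by an averaging
  argument for the primal gap.

  Dual half step ([x_t] fixed).  The short step maximizes the quadratic lower
  model of the payoff on the segment from [y_t] to [u_t], so its progress dominates
  the one of any convenient trial step ([short_step_progress]).  On a general
  compact convex set this removes a multiple of [h_t ^ 2]
  ([progress_diameter]).  On a strongly convex set the oracle point is far in
  the direction of the gradient, and the gradient has norm at least
  [sqrt (2 sigma_t h_t)], so that a multiple of [sqrt (sigma_t h_t) * h_t]
  disappears ([progress_strongly_convex_set]).

  Primal half step ([y_{t+1}] fixed).  Moving [x] by [O(1/n)] perturbs the gap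
  by at most [O(1/n)] times the distance from [y_{t+1}] to the new maximizer,
  because only the difference of two slices of the payoff matters.  By strong
  concavity this distance is [O(sqrt (h_t / sigma_t) + 1 / (n sigma_t))]
  ([gap_drift]).  Decreasing [beta] adds [O(beta_t - beta_{t+1})].

  If [sigma_t] is of order [n ^ (-b)] and [h_t] of order [n ^ (-r)], the drift
  is of order [n ^ (-1 - q)] with [q = (r - b) / 2].  The decrease is of order
  [n ^ (-2 r)] for a general set and [n ^ (- (3 r + b) / 2)] for a strongly
  convex one.  Balancing gives [3 r + b = 2], respectively [r + b = 1], and
  [recursion_rate] turns the balance into [h_t = O(n ^ (-r))].

  The primal gap of the regularized payoff, times [n], grows by at most
  [O(n ^ (-q))] per step: the oracle answer at [y_t] instead of the exact
  maximizer costs [sqrt (h_t / sigma_t)] ([primal_step]).  Hence it is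
  [O(n ^ (-q))] ([averaging_rate]).  Removing the regularization costs
  [O(beta_t)].  With regularization the best choice is [b = q], that is
  [r = 3 b]: this gives [b = 1/5], respectively [b = 1/4].  Without it,
  [b = 0] and [r = 2 q]: this gives [r = 2/3], respectively [r = 1].  No
  logarithm appears, because the accumulated errors [n ^ (-q)] have
  [q <= 1/2].
*)

(** * Euclidean geometry of row vectors *)

Section InnerProduct.
Context {R : realType} {d : nat}.
Implicit Types (u v w : 'rV[R]_d) (a : R).

Lemma dotC u v : dot u v = dot v u.
Proof. by apply: eq_bigr => i _; rewrite mulrC. Qed.

Lemma dotDr u v w : dot u (v + w) = dot u v + dot u w.
Proof. by rewrite /dot -big_split; apply: eq_bigr => i _; rewrite mxE mulrDr. Qed.

Lemma dotZr a u v : dot u (a *: v) = a * dot u v.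
Proof. by rewrite /dot big_distrr; apply: eq_bigr => i _; rewrite mxE mulrCA. Qed.

Lemma dotNr u v : dot u (- v) = - dot u v.
Proof. by rewrite -scaleN1r dotZr mulN1r. Qed.

Lemma dotDl u v w : dot (u + v) w = dot u w + dot v w.
Proof. by rewrite !(dotC _ w) dotDr. Qed.

Lemma dotZl a u v : dot (a *: u) v = a * dot u v.
Proof. by rewrite !(dotC _ v) dotZr. Qed.

Lemma dotNl u v : dot (- u) v = - dot u v.
Proof. by rewrite !(dotC _ v) dotNr. Qed.

Definition dotE := (dotDl, dotDr, dotNl, dotNr, dotZl, dotZr).

Lemma dotvv_ge0 v : 0 <= dot v v.
Proof. by apply: sumr_ge0 => i _; rewrite -expr2 sqr_ge0. Qed.

Lemma enorm_ge0 v : 0 <= enorm v.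
Proof. exact: sqrtr_ge0. Qed.

Lemma enorm_sqr v : enorm v ^+ 2 = dot v v.
Proof. by rewrite sqr_sqrtr ?dotvv_ge0. Qed.

Lemma enorm0 : enorm (0 : 'rV[R]_d) = 0.
Proof. by rewrite /enorm -(scale0r 0) dotZl mul0r sqrtr0. Qed.

Lemma enorm_eq0 v : enorm v = 0 -> v = 0.
Proof.
move=> v0; have : dot v v == 0 by rewrite -enorm_sqr v0 expr0n.
rewrite psumr_eq0 => [|i _]; last by rewrite -expr2 sqr_ge0.
move=> /allP vi0; apply/rowP => i; rewrite mxE; apply/eqP.
by have := vi0 i (mem_index_enum i); rewrite -expr2 sqrf_eq0.
Qed.

Lemma enormZ a v : enorm (a *: v) = `|a| * enorm v.
Proof.
by rewrite /enorm dotZl dotZr mulrA -expr2 sqrtrM ?sqr_ge0 // sqrtr_sqr.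
Qed.

Lemma enormN v : enorm (- v) = enorm v.
Proof. by rewrite -scaleN1r enormZ normrN1 mul1r. Qed.

Lemma enormB u v : enorm (u - v) = enorm (v - u).
Proof. by rewrite -enormN opprB. Qed.

Lemma cauchy_schwarz u v : dot u v <= enorm u * enorm v.
Proof.
have [/enorm_eq0->|u0] := eqVneq (enorm u) 0.
  by rewrite enorm0 mul0r -(scale0r 0) dotZl mul0r.
have [/enorm_eq0->|v0] := eqVneq (enorm v) 0.
  by rewrite enorm0 mulr0 -(scale0r 0) dotZr mul0r.
have uv0 : 0 < enorm u * enorm v by rewrite mulr_gt0 // lt0r enorm_ge0 ?u0 ?v0.
have := dotvv_ge0 (enorm v *: u - enorm u *: v).
rewrite !dotE -!enorm_sqr (dotC v u) => h.
rewrite -subr_ge0 -(pmulr_rge0 _ uv0); lra.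
Qed.

Lemma cauchy_schwarz_abs u v : `|dot u v| <= enorm u * enorm v.
Proof.
rewrite ler_norml cauchy_schwarz andbT lerNl -dotNl.
by rewrite (le_trans (cauchy_schwarz _ _)) // enormN.
Qed.

Lemma enormD u v : enorm (u + v) <= enorm u + enorm v.
Proof.
rewrite -(@ler_pXn2r _ 2) ?nnegrE ?addr_ge0 ?enorm_ge0 //.
rewrite enorm_sqr sqrrD !enorm_sqr !dotE (dotC v u).
have := cauchy_schwarz u v; lra.
Qed.

Lemma enorm_le_coord v (M : R) :
  (forall i, `|v ord0 i| <= M) -> enorm v ^+ 2 <= M ^+ 2 *+ d.
Proof.
move=> vM; rewrite enorm_sqr.
have -> : M ^+ 2 *+ d = \sum_(i < d) M ^+ 2 by rewrite sumr_const card_ord.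
apply: ler_sum => i _; rewrite -expr2 -(real_normK (num_real _)).
by rewrite lerXn2r ?nnegrE // (le_trans _ (vM i)).
Qed.

End InnerProduct.

Lemma coord_le_norm {R : realType} {d : nat} (u : 'rV[R]_d) i :
  `|u ord0 i| <= `|u|.
Proof.
rewrite [leRHS]mx_normrE.
exact: (@le_bigmax _ _ _ 0 (fun j : 'I_1 * 'I_d => `|u j.1 j.2|) (ord0, i)).
Qed.

Lemma compact_diameter {R : realType} {d : nat} (D : set 'rV[R]_d) :
  compact D -> exists2 B : R, 0 < B & forall u v, D u -> D v -> enorm (u - v) <= B.
Proof.
move=> /compact_bounded[M [_ /(_ (`|M| + 1))]].
rewrite (le_lt_trans (ler_norm M)) ?ltrDl // => /(_ isT) DM.
set M' := `|M| + 1 in DM; have M'0 : 0 <= M' by rewrite addr_ge0.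
pose S := ((M' + M') ^+ 2 *+ d : R).
have S0 : 0 <= S by rewrite mulrn_wge0 ?sqr_ge0.
exists (S + 1) => [|u v Du Dv]; first by rewrite ltr_wpDl.
have h : enorm (u - v) ^+ 2 <= S.
  apply: enorm_le_coord => i; rewrite !mxE (le_trans (ler_normB _ _)) // lerD //.
    by rewrite (le_trans _ (DM _ Du)) // coord_le_norm.
  by rewrite (le_trans _ (DM _ Dv)) // coord_le_norm.
have := enorm_ge0 (u - v); nra.
Qed.

Section Segment.
Context {R : realType} {d : nat}.
Implicit Types (f : 'rV[R]_d -> R) (a u v : 'rV[R]_d) (D : set 'rV[R]_d).

Lemma i01P {s : R} : 0 <= s <= 1 -> exists t : {i01 R}, t%:num = s.
Proof.
move=> s01; unshelve eexists (Itv.mk (x := s) _) => //.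
by apply/andP; split; rewrite ?num_real ?in_itv.
Qed.

(** Segments are parametrized from their first endpoint throughout, the form in
    which both updates of the algorithm are written. *)
Lemma convE_segment (t : {i01 R}) u v :
  (v : convex_lmodType 'rV[R]_d) <| t |> u = u + t%:num *: (v - u).
Proof.
suff -> : u + t%:num *: (v - u) = t%:num *: v + (1 - t%:num) *: u by [].
by rewrite scalerBr scalerBl scale1r addrCA.
Qed.

Lemma convex_setP D u v (s : R) : convex_set D -> D u -> D v -> 0 <= s <= 1 ->
  D (u + s *: (v - u)).
Proof.
move=> cD Du Dv s01; have [t <-] := i01P s01.
by have := cD v u t; rewrite !inE => /(_ Dv Du); rewrite convE_segment.
Qed.

Lemma derive_grad f a v : differentiable f a -> 'D_v f a = dot (grad f a) v.
Proof.
move=> df; rewrite deriveE // [in LHS](row_sum_delta v) linear_sum.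
by apply: eq_bigr => i _; rewrite linearZ /= mxE deriveE // mulrC.
Qed.

Lemma segment_derive f a v (s : R) : differentiable f (a + s *: v) ->
  is_derive s 1 (fun r : R => f (a + r *: v)) (dot (grad f (a + s *: v)) v).
Proof.
move=> df.
have g_diff : is_diff s (fun r : R => a + r *: v) (fun r : R => r *: v).
  have -> : (fun r : R => r *: v) = 0 + (fun r : R => r *: v) by rewrite add0r.
  exact: is_diffD.
have [dg eg] := g_diff.
have dfg : differentiable (f \o (fun r : R => a + r *: v)) s.
  exact: differentiable_comp.
apply: DeriveDef; first exact: diff_derivable.
by rewrite deriveE // diff_comp //= eg scale1r -deriveE // derive_grad.
Qed.

End Segment.

(** * Mean value estimates along segments *)

Lemma MVT01 {R : realType} (f df : R -> R) :
  (forall s : R, 0 <= s <= 1 -> is_derive s 1 f (df s)) ->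
  exists2 c, 0 < c < 1 & f 1 - f 0 = df c.
Proof.
move=> fdf; have [||c] := @MVT R f df 0 1 ltr01.
- by move=> s; rewrite in_itv /= => /andP[s0 s1]; apply: fdf; rewrite !ltW.
- apply: derivable_within_continuous => s; rewrite in_itv /= => s01.
  by have [] := fdf s s01.
- by rewrite in_itv /= subr0 mulr1 => c01 e; exists c.
Qed.

(** Restricted to [D]: the payoff may fail to be differentiable far from it. *)
Definition smooth_on {R : realType} {d : nat} (M : R) (D : set 'rV[R]_d)
    (f : 'rV[R]_d -> R) : Prop :=
  (forall a, D a -> differentiable f a) /\
  (forall a b, D a -> D b ->
     enorm (grad f a - grad f b) <= M * enorm (a - b)).

Section Smooth.
Context {R : realType} {d : nat}.
Implicit Types (f g : 'rV[R]_d -> R) (u v a b : 'rV[R]_d) (D : set 'rV[R]_d).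

Lemma smooth_quadratic D M f u v : convex_set D -> smooth_on M D f ->
  D u -> D v ->
  `|f v - f u - dot (grad f u) (v - u)| <= M / 2 * enorm (v - u) ^+ 2.
Proof.
move=> cD [df lipf] Du Dv; set w := v - u.
(* The mean value theorem for [e (f - tangent) - parabola], whose derivative is
   nonpositive; the two signs [e] give the two inequalities. *)
have key (e : R) : `|e| = 1 ->
    e * (f v - f u - dot (grad f u) w) <= M / 2 * enorm w ^+ 2.
  move=> e1.
  pose q : R -> R := fun s => e * (f (u + s *: w) - s * dot (grad f u) w)
                       - s ^+ 2 * (M / 2 * enorm w ^+ 2).
  pose dq : R -> R := fun s => e * dot (grad f (u + s *: w) - grad f u) w
                       - s * (M * enorm w ^+ 2).
  have [s s01|c /andP[c0 c1]] := @MVT01 _ q dq.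
    have Dfs := segment_derive (df _ (convex_setP cD Du Dv s01)).
    by apply: is_derive_eq; rewrite /dq dotDl dotNl /GRing.scale /=; field.
  rewrite {1}/q {1}/q scale1r scale0r addr0 {1}/w subrKC => qE.
  rewrite -subr_le0 (_ : _ - _ = dq c); last by rewrite -qE; ring.
  rewrite /dq subr_le0.
  have Dc : D (u + c *: w) by apply: convex_setP => //; rewrite !ltW.
  apply: le_trans (ler_norm _) _; rewrite normrM e1 mul1r.
  apply: le_trans (cauchy_schwarz_abs _ _) _.
  rewrite expr2 !mulrA ler_wpM2r ?enorm_ge0 // (le_trans (lipf _ _ Dc Du)) //.
  by rewrite addrAC subrr add0r enormZ gtr0_norm // mulrCA mulrA.
rewrite ler_norml; have := key 1 (normr1 _); have := key (-1).
rewrite normrN1 => /(_ erefl); rewrite !mulN1r mul1r lerNl => -> ->//.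
Qed.

(** Applied to two slices of the payoff, whose gradients are [O(|y - y'|)] apart
    although each slice varies at a larger rate. *)
Lemma diff_lipschitz D (K : R) f g u v : convex_set D ->
  (forall a, D a -> differentiable f a) ->
  (forall a, D a -> differentiable g a) ->
  (forall a, D a -> enorm (grad f a - grad g a) <= K) ->
  D u -> D v ->
  `|(f v - g v) - (f u - g u)| <= K * enorm (v - u).
Proof.
move=> cD df dg fgK Du Dv; set w := v - u.
have [s s01|c /andP[c0 c1]] := @MVT01 _ (fun s : R => f (u + s *: w) - g (u + s *: w))
   (fun s => dot (grad f (u + s *: w) - grad g (u + s *: w)) w).
  have Ds := convex_setP cD Du Dv s01.
  have Dfs := segment_derive (df _ Ds).
  have Dgs := segment_derive (dg _ Ds).
  by rewrite dotDl dotNl; apply: is_deriveB.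
rewrite scale1r scale0r addr0 /w subrKC => e.
rewrite e (le_trans (cauchy_schwarz_abs _ _)) // ler_wpM2r ?enorm_ge0 //.
by apply: fgK; apply: convex_setP; rewrite ?ltW.
Qed.

End Smooth.

(** * Smooth concave functions and the short step *)

(** Stands for the limit [s -> 0] when first-order conditions are extracted from
    inequalities along a segment; the quadratic error is the slope [c]. *)
Lemma le_small_slope {R : realType} (a b c : R) :
  (forall s : R, 0 < s <= 1 -> a <= b + s * c) -> a <= b.
Proof.
move=> h; rewrite leNgt; apply/negP => ba.
have den : 0 < a - b + `|c| by rewrite ltr_wpDr ?subr_gt0.
have := h ((a - b) / (a - b + `|c|)).
rewrite divr_gt0 ?subr_gt0 // ler_pdivrMr // mul1r lerDl normr_ge0 => /(_ isT).
rewrite -lerBlDl mulrAC ler_pdivlMr // mulrDr.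
have := ler_norm c; have ba' : 0 < a - b by rewrite subr_gt0.
have := mulr_gt0 ba' ba'; have := ler_wpM2l (ltW ba') (ler_norm c); lra.
Qed.

Section Concave.
Context {R : realType} {d : nat}.
Variables (D : set 'rV[R]_d) (M : R) (f : 'rV[R]_d -> R).
Hypotheses (cD : convex_set D) (fM : smooth_on M D f).
Implicit Types (u v w y : 'rV[R]_d).

Lemma smooth_le u v (s : R) : D u -> D v -> 0 <= s <= 1 ->
  f (u + s *: (v - u)) <=
    f u + s * dot (grad f u) (v - u) + s ^+ 2 * (M / 2 * enorm (v - u) ^+ 2).
Proof.
move=> Du Dv s01.
have := smooth_quadratic cD fM Du (convex_setP cD Du Dv s01).
rewrite [u + _ - u]addrC addKr dotZr enormZ exprMn real_normK ?num_real //.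
rewrite ler_norml => /andP[_]; lra.
Qed.

Lemma smooth_ge u v (s : R) : D u -> D v -> 0 <= s <= 1 ->
  f u + s * dot (grad f u) (v - u) - s ^+ 2 * (M / 2 * enorm (v - u) ^+ 2) <=
    f (u + s *: (v - u)).
Proof.
move=> Du Dv s01.
have := smooth_quadratic cD fM Du (convex_setP cD Du Dv s01).
rewrite [u + _ - u]addrC addKr dotZr enormZ exprMn real_normK ?num_real //.
rewrite ler_norml => /andP[+ _]; lra.
Qed.

Lemma convex_above_tangent u v : convex_function D f -> D u -> D v ->
  f u + dot (grad f u) (v - u) <= f v.
Proof.
move=> cf Du Dv.
apply: (@le_small_slope _ _ _ (M / 2 * enorm (v - u) ^+ 2)) => s /andP[s0 s1].
have s01 : 0 <= s <= 1 by rewrite ltW.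
have := smooth_ge Du Dv s01.
have [t tE] := i01P s01.
have := cf t v u; rewrite !inE => /(_ Dv Du); rewrite convE_segment convRE tE /=.
set q := enorm _ ^+ 2; rewrite /unstable.onem => h1 h2.
rewrite -(ler_pM2l s0); lra.
Qed.

Variable sigma : R.
Hypothesis fsigma : strongly_concave sigma D f.

Lemma strongly_concave_segment u v (s : R) : D u -> D v -> 0 <= s <= 1 ->
  f u + s * (f v - f u + sigma / 2 * (1 - s) * enorm (v - u) ^+ 2)
    <= f (u + s *: (v - u)).
Proof.
move=> Du Dv s01; have := fsigma Dv Du s01.
rewrite (_ : s *: v + _ = u + s *: (v - u)); first lra.
by rewrite scalerBr scalerBl scale1r addrCA.
Qed.

Lemma concave_below_tangent u v : D u -> D v ->
  f v <= f u + dot (grad f u) (v - u) - sigma / 2 * enorm (v - u) ^+ 2.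
Proof.
move=> Du Dv.
apply: (@le_small_slope _ _ _ ((M + sigma) / 2 * enorm (v - u) ^+ 2)) => s /andP[s0 s1].
have s01 : 0 <= s <= 1 by rewrite ltW.
have := smooth_le Du Dv s01.
have := strongly_concave_segment Du Dv s01.
set q := enorm _ ^+ 2; set g := dot _ _ => h1 h2.
rewrite -(ler_pM2l s0); lra.
Qed.

(** Stopping short of the maximizer on the segment towards [y] cannot improve
    the value, while strong concavity gains a quadratic term there. *)
Lemma maximizer_growth ystar y : D ystar -> (forall w, D w -> f w <= f ystar) ->
  D y -> sigma / 2 * enorm (y - ystar) ^+ 2 <= f ystar - f y.
Proof.
move=> Ds smax Dy.
apply: (@le_small_slope _ _ _ (sigma / 2 * enorm (y - ystar) ^+ 2)) => s /andP[s0 s1].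
have s01 : 0 <= s <= 1 by rewrite ltW.
have := strongly_concave_segment Ds Dy s01.
have := smax _ (convex_setP cD Ds Dy s01).
set q := enorm _ ^+ 2 => h1 h2.
rewrite -(ler_pM2l s0); lra.
Qed.

Hypothesis (sigma0 : 0 < sigma) (M0 : 0 <= M).

(** The lower and the upper quadratic model of [f] have to be compatible. *)
Lemma strong_concavity_le_smoothness u v : D u -> D v ->
  sigma * enorm (v - u) ^+ 2 <= M * enorm (v - u) ^+ 2.
Proof.
move=> Du Dv; have := concave_below_tangent Du Dv.
have := @smooth_ge u v 1 Du Dv; rewrite ler01 lexx scale1r subrKC => /(_ isT).
lra.
Qed.

(** Maximize [|g| r - sigma r^2 / 2], an upper bound for the increase of [f] at
    distance [r], over all [r]. *)
Lemma grad_lower_bound y v : D y -> D v ->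
  2 * sigma * (f v - f y) <= enorm (grad f y) ^+ 2.
Proof.
move=> Dy Dv; have := concave_below_tangent Dy Dv.
have := cauchy_schwarz (grad f y) (v - y).
set g := enorm (grad f y); set r := enorm _ => h1 h2.
have h3 : f v - f y <= g * r - sigma / 2 * r ^+ 2 by lra.
have := ler_wpM2l (ltW (mulr_gt0 (ltr0Sn R 1) sigma0)) h3.
have := sqr_ge0 (g - sigma * r); nra.
Qed.

Section ShortStep.
Variables (L beta : R) (y u : 'rV[R]_d).
Hypotheses (ME : M = L + beta) (Dy : D y).
Hypothesis (ulmo : is_lmo D (- grad f y) u).

Let g := grad f y.
Let y' := y + dual_step L beta g u y *: (u - y).

(** The tangent plane lies above [f], and the oracle maximizes it. *)
Lemma lmo_gap w : D w -> f w - f y <= dot g (u - y).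
Proof.
move=> Dw; have := concave_below_tangent Dy Dw.
have [_ /(_ _ Dw)] := ulmo; rewrite !dotNl !dotDr !dotNr -/g.
have : 0 <= sigma / 2 * enorm (w - y) ^+ 2.
  by rewrite mulr_ge0 ?sqr_ge0 // divr_ge0 // ltW.
lra.
Qed.

Lemma fw_gap_ge0 : 0 <= dot g (u - y).
Proof. by rewrite (le_trans _ (lmo_gap Dy)) // subrr. Qed.

Lemma dual_step01 : 0 <= dual_step L beta g u y <= 1.
Proof.
rewrite /dual_step -ME le_min ge_min lexx orbT ler01 !andbT.
by rewrite divr_ge0 ?fw_gap_ge0 // mulr_ge0 ?sqr_ge0.
Qed.

Lemma short_step_in : D y'.
Proof. by have [Du _] := ulmo; apply: convex_setP dual_step01. Qed.

(** The short step maximizes the quadratic lower model over the unit interval, and the model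
    at a trial step [s] as above is at least [s / 2] times the gap of the oracle.
    The progress can thus be bounded through any convenient [s]. *)
Lemma short_step_progress (s : R) : 0 <= s <= 1 ->
  s * (M * enorm (u - y) ^+ 2) <= dot g (u - y) ->
  f y + s / 2 * dot g (u - y) <= f y'.
Proof.
move=> /andP[s0 s1] sG; have [Du _] := ulmo.
apply: le_trans (smooth_ge Dy Du dual_step01).
rewrite /dual_step -ME -/g; have := fw_gap_ge0.
have := strong_concavity_le_smoothness Dy Du.
move: sG; set G := dot g _; set q := enorm _ ^+ 2 => sG sq G0.
have q0 : 0 <= q by apply: sqr_ge0.
(* The quotient defining the step is then 0 / 0: strong concavity leaves only [u = y]. *)
have [Q0|] := eqVneq (M * q) 0.
  have qE : q = 0 by apply: le_anti; rewrite q0 andbT -(pmulr_rle0 _ sigma0) -Q0.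
  have dE : u - y = 0 by apply/enorm_eq0/eqP; rewrite -sqrf_eq0 -/q qE.
  by rewrite /G dE -(scale0r 0) dotZr qE !(mul0r, mulr0) subr0.
have Q0 : 0 <= M * q by rewrite mulr_ge0.
move=> /negbTE Qn0; have {}Q0 : 0 < M * q by rewrite lt0r Qn0.
rewrite [M / 2 * q]mulrAC; set Q := M * q in sG Q0 *.
have [GQ|/ltW GQ] := leP (G / Q) 1.
  have GE : G = G / Q * Q by rewrite divfK ?gt_eqF.
  have sGQ : s <= G / Q by rewrite ler_pdivlMr.
  have : s * G <= G / Q * G by rewrite ler_wpM2r.
  have : (G / Q) ^+ 2 * (Q / 2) = G / Q * G / 2 by rewrite {3}GE; ring.
  lra.
have : Q <= G by rewrite -[Q]mul1r -ler_pdivlMr.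
have : s * G <= G by rewrite ler_piMl.
lra.
Qed.

(** The trial step is [h / (H + M B^2)] with [h = f v - f y]: at most one because
    [h <= H], and short enough because [h] is below the gap of the oracle. *)
Lemma progress_diameter (v : 'rV[R]_d) (H B : R) : D v -> 0 < H ->
  0 <= f v - f y <= H -> enorm (u - y) <= B ->
  f y + (f v - f y) ^+ 2 / (2 * (H + M * B ^+ 2)) <= f y'.
Proof.
move=> Dv H0 /andP[h0 hH] uB; have := lmo_gap Dv.
set h := f v - f y in h0 hH * => hG.
have B2 : enorm (u - y) ^+ 2 <= B ^+ 2.
  by rewrite lerXn2r ?nnegrE ?enorm_ge0 // (le_trans (enorm_ge0 _) uB).
have MB0 : 0 <= M * B ^+ 2 by rewrite mulr_ge0 ?sqr_ge0.
have A0 : 0 < H + M * B ^+ 2 by rewrite ltr_wpDr.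
have s0 : 0 <= h / (H + M * B ^+ 2) by rewrite divr_ge0 // ltW.
have sA : h / (H + M * B ^+ 2) * (H + M * B ^+ 2) = h by rewrite divfK ?gt_eqF.
apply: le_trans (@short_step_progress (h / (H + M * B ^+ 2)) _ _).
- rewrite lerD2l invfM mulrA (mulrC _ (2^-1)) expr2.
  have : h / (H + M * B ^+ 2) * h <= h / (H + M * B ^+ 2) * dot g (u - y).
    by rewrite ler_wpM2l.
  lra.
- by rewrite s0 ler_pdivrMr // mul1r ler_wpDr.
- apply: le_trans hG; rewrite -[leRHS]sA ler_wpM2l //.
  by rewrite ler_wpDl ?(ltW H0) // ler_wpM2l.
Qed.

(** The midpoint of [y] and [u], pushed in the direction of the gradient by
    [alpha |u - y|^2 / 8], still belongs to [D], and the oracle does at least as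
    well as this point. *)
Lemma strongly_convex_set_gap alpha : 0 < alpha -> strongly_convex_set alpha D ->
  alpha / 4 * enorm g * enorm (u - y) ^+ 2 <= dot g (u - y).
Proof.
move=> alpha0 Dalpha; have [g0|g0] := eqVneq (enorm g) 0.
  by rewrite g0 mulr0 mul0r fw_gap_ge0.
have [Du ule] := ulmo.
have half : (0 <= 2^-1 :> R) && (2^-1 <= 1 :> R) by apply/andP; split; lra.
have := Dalpha u y ((enorm g)^-1 *: g) _ Du Dy _ half.
rewrite enormZ ger0_norm ?invr_ge0 ?enorm_ge0 // mulVf // => /(_ erefl) /ule.
rewrite !dotNl !dotDr !dotNr !dotZr -enorm_sqr -/g expr2 mulKf //.
lra.
Qed.

(** The trial step is [w / (W + 4 M / alpha)], where [w] is the lower bound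
    [sqrt (2 sigma h)] for the norm of the gradient. *)
Lemma progress_strongly_convex_set (v : 'rV[R]_d) (alpha W : R) : D v ->
  0 < alpha -> strongly_convex_set alpha D ->
  0 <= f v - f y -> 0 < W -> Num.sqrt (2 * sigma * (f v - f y)) <= W ->
  f y + Num.sqrt (2 * sigma * (f v - f y)) * (f v - f y)
          / (2 * (W + 4 * M / alpha)) <= f y'.
Proof.
move=> Dv alpha0 Dalpha; have := grad_lower_bound Dy Dv; have := lmo_gap Dv.
set h := f v - f y => hG hgrad h0 W0 wW; set w := Num.sqrt _ in wW *.
have w0 : 0 <= w by apply: sqrtr_ge0.
have wg : w <= enorm g.
  rewrite -(@ler_pXn2r _ 2) ?nnegrE ?enorm_ge0 // sqr_sqrtr //.
  by rewrite !mulr_ge0 // ltW.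
have Ma0 : 0 <= 4 * M / alpha by rewrite divr_ge0 ?mulr_ge0 // ltW.
have A0 : 0 < W + 4 * M / alpha by rewrite ltr_wpDr.
have s0 : 0 <= w / (W + 4 * M / alpha) by rewrite divr_ge0 // ltW.
have sA : w / (W + 4 * M / alpha) * (W + 4 * M / alpha) = w by rewrite divfK ?gt_eqF.
apply: le_trans (@short_step_progress (w / (W + 4 * M / alpha)) _ _).
- rewrite lerD2l invfM mulrA.
  have : w / (W + 4 * M / alpha) * h <= w / (W + 4 * M / alpha) * dot g (u - y).
    by rewrite ler_wpM2l.
  lra.
- by rewrite s0 ler_pdivrMr // mul1r ler_wpDr.
- apply: le_trans (strongly_convex_set_gap alpha0 Dalpha).
  rewrite mulrA ler_wpM2r ?sqr_ge0 //.
  apply: (@le_trans _ _ (alpha / 4 * w)); last by rewrite ler_wpM2l // divr_ge0 // ltW.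
  set s := w / _ in s0 sA *.
  have -> : s * M = alpha / 4 * (s * (4 * M / alpha)).
    rewrite [RHS]mulrCA; congr (s * _).
    by rewrite [alpha / 4 * _]mulrC mulrA divfK ?gt_eqF // mulrAC divff ?mul1r.
  rewrite ler_wpM2l ?divr_ge0 ?(ltW alpha0) //.
  by rewrite -[leRHS]sA ler_wpM2l // ler_wpDl // ltW.
Qed.

End ShortStep.
End Concave.

(** * The quadratic regularizer *)

Section Regularizer.
Context {R : realType} {d : nat}.
Variables (c : 'rV[R]_d) (beta : R).
Let q (y : 'rV[R]_d) : R := beta / 2 * enorm (y - c) ^+ 2.

Let coord i (y : 'rV[R]_d) : R^o := y ord0 i.

Let coord_linear i : linear (coord i).
Proof. by move=> k u v; rewrite /coord !mxE. Qed.

HB.instance Definition _ i :=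
  GRing.isLinear.Build R 'rV[R]_d R^o *:%R (coord i) (coord_linear i).

Lemma coord_is_diff i (a : 'rV[R]_d) :
  is_diff a (fun y : 'rV[R]_d => y ord0 i - c ord0 i) (fun v => v ord0 i).
Proof.
have h : is_diff a (fun y : 'rV[R]_d => y ord0 i : R) (fun v => v ord0 i).
  apply: DiffDef; first exact: differentiable_coord.
  exact: (diff_lin (f := coord i) _ (@coord_continuous _ _ _ _ _)).
rewrite -[X in is_diff _ _ X]subr0; exact: is_diffB.
Qed.

Let qE : q = (beta / 2) *:
  \sum_(i < d) (fun y : 'rV[R]_d => y ord0 i - c ord0 i) ^+ 2.
Proof.
apply/funext => y; rewrite /q enorm_sqr /dot fct_sumE /=; congr (_ * _).
by apply: eq_bigr => i _; rewrite !mxE exprfctE expr2.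
Qed.

Lemma regularizer_differentiable a : differentiable q a.
Proof.
rewrite qE; apply: differentiableZ; apply: differentiable_sum => i.
by apply: differentiableX; have [] := coord_is_diff i a.
Qed.

Lemma regularizer_derive a v : 'D_v q a = beta * dot (a - c) v.
Proof.
have Dcoord i : is_derive a v (fun y : 'rV[R]_d => y ord0 i - c ord0 i) (v ord0 i).
  have [df e] := coord_is_diff i a.
  by apply: DeriveDef; [exact: diff_derivable | rewrite deriveE // e].
have D : is_derive a v q ((beta / 2) *:
    \sum_(i < d) (2 * (a ord0 i - c ord0 i) ^+ 1) *: v ord0 i).
  rewrite qE; apply: is_deriveZ; apply: is_derive_sum => i.
  exact: is_deriveX.
rewrite derive_val /dot !scaler_sumr mulr_sumr; apply: eq_bigr => i _.
by rewrite !mxE /GRing.scale /=; field.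
Qed.

End Regularizer.

Lemma gradB {R : realType} {d : nat} (f g : 'rV[R]_d -> R) a :
  differentiable f a -> differentiable g a ->
  grad (fun y => f y - g y) a = grad f a - grad g a.
Proof.
move=> df dg; apply/rowP => i; rewrite !mxE.
by apply: deriveB; apply: diff_derivable.
Qed.

Lemma grad_regularizer {R : realType} {d : nat} (c a : 'rV[R]_d) (beta : R) :
  grad (fun y => beta / 2 * enorm (y - c) ^+ 2) a = beta *: (a - c).
Proof.
apply/rowP => i; rewrite !mxE regularizer_derive; congr (_ * _).
rewrite /dot (bigD1 i) //= !mxE !eqxx mulr1 big1 ?addr0 // => j /negbTE ji.
by rewrite !mxE ji andbF mulr0.
Qed.

(** * One step of the saddle-point dynamics *)

Section Saddle.
Context {R : realType} {dx dy : nat}.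
Variables (X : set 'rV[R]_dx) (Y : set 'rV[R]_dy).
Variables (L : 'rV[R]_dx -> 'rV[R]_dy -> R) (mu Lxx Lyy Lyx : R).
Hypothesis sa : standing_assumption X Y L mu Lxx Lyy Lyx.
Implicit Types (x z : 'rV[R]_dx) (y w : 'rV[R]_dy).

Let cX : convex_set X := sa_X_convex sa.
Let cY : convex_set Y := sa_Y_convex sa.

Lemma payoff_differentiable x y : X x -> Y y ->
  differentiable (fun q : 'rV[R]_dx * 'rV[R]_dy => L q.1 q.2) (x, y).
Proof.
by move=> Xx Yy; have [U [_ sU C1]] := sa_C1 sa; have [] := C1 (x, y) (sU (x, y) (conj Xx Yy)).
Qed.

Lemma smooth_x y : Y y -> smooth_on Lxx X (L^~ y).
Proof.
move=> Yy; split=> [x Xx|x x' Xx Xx'].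
  have -> : L^~ y = (fun q => L q.1 q.2) \o (fun x : 'rV[R]_dx => (x, y)) by [].
  by apply: differentiable_comp (payoff_differentiable Xx Yy); apply: differentiable_pair.
have := sa_gradx_lipschitz sa Xx Yy Xx' Yy.
by rewrite subrr enorm0 mulr0 addr0.
Qed.

Lemma smooth_y x : X x -> smooth_on Lyy Y (L x).
Proof.
move=> Xx; split=> [y Yy|y y' Yy Yy'].
  have -> : L x = (fun q => L q.1 q.2) \o (fun y : 'rV[R]_dy => (x, y)) by [].
  by apply: differentiable_comp (payoff_differentiable Xx Yy); apply: differentiable_pair.
have := sa_grady_lipschitz sa Xx Yy Xx Yy'.
by rewrite subrr enorm0 mulr0 add0r.
Qed.

(** A discrete form of a bound on the mixed second derivative of the payoff. *)
Lemma payoff_mixed_lipschitz x x' y y' : X x -> X x' -> Y y -> Y y' ->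
  `|(L x' y - L x' y') - (L x y - L x y')| <= Lyx * enorm (y - y') * enorm (x' - x).
Proof.
move=> Xx Xx' Yy Yy'.
have [dLy _] := smooth_x Yy; have [dLy' _] := smooth_x Yy'.
apply: (diff_lipschitz cX dLy dLy') => //.
move=> z Xz; have := sa_gradx_lipschitz sa Xz Yy Xz Yy'.
by rewrite subrr enorm0 mulr0 add0r.
Qed.

Section Regularized.
Variable y0 : 'rV[R]_dy.
Hypothesis Yy0 : Y y0.

Let Lr beta := regularized L y0 beta.

Lemma regularized_smooth beta x : 0 <= beta -> X x ->
  smooth_on (Lyy + beta) Y (Lr beta x).
Proof.
move=> beta0 Xx; have [dL lipL] := smooth_y Xx.
split=> [y Yy|y y' Yy Yy'].
  by apply: differentiableB; [exact: dL | exact: regularizer_differentiable].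
rewrite !gradB; try exact: dL; try exact: regularizer_differentiable.
rewrite !grad_regularizer opprB [X in _ + X]addrC addrACA -scalerN -scalerDr.
rewrite opprB [c in beta *: c]addrC subrKA.
apply: le_trans (enormD _ _) _; rewrite enormZ ger0_norm // (enormB y') mulrDl.
by rewrite lerD2r lipL.
Qed.

(** The regularizer satisfies its own strong concavity inequality with equality. *)
Lemma regularized_strongly_concave beta x : X x ->
  strongly_concave (mu + beta) Y (Lr beta x).
Proof.
move=> Xx u v xi Yu Yv xi01; have := sa_strongly_concave sa Xx Yu Yv xi01.
rewrite /Lr /regularized.
have -> : u - v = (u - y0) - (v - y0) by rewrite opprB addrA subrK.
have -> : xi *: u + (1 - xi) *: v - y0 = xi *: (u - y0) + (1 - xi) *: (v - y0).
  by rewrite !scalerBr addrACA -opprD -scalerDl subrKC scale1r.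
move: (u - y0) (v - y0) => a b.
rewrite !enorm_sqr !dotE (dotC b a); lra.
Qed.

(** Turns the supremum into a value: maximizers are what strong concavity is about. *)
Lemma max_attained beta x : 0 <= beta -> X x -> exists2 y, Y y &
  primal_fun Y (Lr beta) x = Lr beta x y /\ forall w, Y w -> Lr beta x w <= Lr beta x y.
Proof.
move=> beta0 Xx; have [dLr _] := regularized_smooth beta0 Xx.
have [|ys] := @EVT_max_rV _ _ (Lr beta x) Y (sa_Y_nonempty sa) (sa_Y_compact sa).
  apply: continuous_in_subspaceT => y; rewrite inE => Yy.
  exact: differentiable_continuous (dLr _ Yy).
rewrite inE => Yys ymax; exists ys => //.
have {}ymax w : Y w -> Lr beta x w <= Lr beta x ys by move=> Yw; apply: ymax; rewrite inE.
split=> //; apply: le_anti; apply/andP; split.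
  by apply: ge_sup => [|_ [w Yw <-]]; [exists (Lr beta x ys), ys | exact: ymax].
apply: ub_le_sup; last by exists ys.
by exists (Lr beta x ys) => _ [w Yw <-]; exact: ymax.
Qed.

Local Notation F beta := (primal_fun Y (Lr beta)).
Local Notation gap beta := (gap_dual Y (Lr beta)).

Lemma primal_fun_ge beta x y : 0 <= beta -> X x -> Y y -> Lr beta x y <= F beta x.
Proof. by move=> b0 Xx Yy; have [ys _ [-> ->]] := max_attained b0 Xx. Qed.

Lemma gapE beta x y :
  gap beta x y = F beta x - (L x y - beta / 2 * enorm (y - y0) ^+ 2).
Proof. by []. Qed.

Lemma gap_ge0 beta x y : 0 <= beta -> X x -> Y y -> 0 <= gap beta x y.
Proof. by move=> *; rewrite subr_ge0 primal_fun_ge. Qed.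

Lemma regularized0 : Lr 0 = L.
Proof.
by apply/funext => x; apply/funext => y; rewrite /Lr /regularized !mul0r subr0.
Qed.

Section Diameters.
Variables (B : R).
Hypotheses (B0 : 0 < B).
Hypothesis XB : forall u v, X u -> X v -> enorm (u - v) <= B.
Hypothesis YB : forall u v, Y u -> Y v -> enorm (u - v) <= B.

Lemma enorm_sqr_le_diameter u v : Y u -> Y v -> enorm (u - v) ^+ 2 <= B ^+ 2.
Proof.
by move=> Yu Yv; rewrite lerXn2r ?nnegrE ?enorm_ge0 // ?(ltW B0) // YB.
Qed.

Lemma primal_fun_antitone beta beta' x : 0 <= beta' <= beta -> X x ->
  F beta x <= F beta' x.
Proof.
move=> /andP[b0 bb] Xx.
have [ys Ys [-> _]] := max_attained (le_trans b0 bb) Xx.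
apply: le_trans (primal_fun_ge b0 Xx Ys).
by rewrite lerB // ler_wpM2r ?sqr_ge0 // ler_pM2r.
Qed.

Lemma primal_fun_perturb beta beta' x : 0 <= beta' <= beta -> X x ->
  F beta' x <= F beta x + (beta - beta') / 2 * B ^+ 2.
Proof.
move=> /andP[b0 bb] Xx.
have [ys Ys [-> _]] := max_attained b0 Xx.
have := primal_fun_ge (le_trans b0 bb) Xx Ys.
have : (beta - beta') / 2 * enorm (ys - y0) ^+ 2 <= (beta - beta') / 2 * B ^+ 2.
  by rewrite ler_wpM2l ?enorm_sqr_le_diameter // divr_ge0 // subr_ge0.
rewrite /Lr /regularized; lra.
Qed.

Lemma gap_perturb beta beta' x y : 0 <= beta' <= beta -> X x -> Y y ->
  gap beta' x y <= gap beta x y + (beta - beta') / 2 * B ^+ 2.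
Proof.
move=> bb Xx Yy; have := primal_fun_perturb bb Xx.
rewrite !gapE; have : beta' / 2 * enorm (y - y0) ^+ 2 <= beta / 2 * enorm (y - y0) ^+ 2.
  by case/andP: bb => _ bb; rewrite ler_wpM2r ?sqr_ge0 // ler_pM2r.
lra.
Qed.

(** By concavity the gap is at most the norm of the gradient times the diameter,
    and the gradient is bounded by its Lipschitz continuity. *)
Lemma gap_bounded (bmax : R) : 0 <= bmax -> exists2 H : R, 0 < H &
  forall beta x y, 0 <= beta <= bmax -> X x -> Y y -> gap beta x y <= H.
Proof.
move=> bmax0; have [x0 Xx0] := sa_X_nonempty sa.
pose G := enorm (grady L x0 y0) + (Lyx * B + Lyy * B).
have G0 : 0 <= G.
  by rewrite !addr_ge0 ?enorm_ge0 // mulr_ge0 ?(ltW B0) ?(sa_Lyy_ge0 sa) ?ltW ?(sa_Lyx_gt0 sa).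
exists (G * B + bmax / 2 * B ^+ 2 + 1) => [|beta x y /andP[b0 bb] Xx Yy].
  by rewrite ltr_wpDl // addr_ge0 ?mulr_ge0 ?sqr_ge0 ?divr_ge0 // ltW.
have [ys Ys [FE _]] := max_attained b0 Xx.
rewrite gapE FE /Lr /regularized.
have := concave_below_tangent cY (smooth_y Xx) (sa_strongly_concave sa Xx) Yy Ys.
have : 0 <= mu / 2 * enorm (ys - y) ^+ 2.
  by rewrite mulr_ge0 ?sqr_ge0 ?divr_ge0 // (sa_mu_ge0 sa).
have : dot (grad (L x) y) (ys - y) <= G * B.
  apply: le_trans (cauchy_schwarz _ _) _.
  rewrite ler_pM ?enorm_ge0 ?YB // -[grad _ _](subrK (grady L x0 y0)).
  apply: le_trans (enormD _ _) _; rewrite addrC lerD2l.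
  apply: le_trans (sa_grady_lipschitz sa Xx Yy Xx0 Yy0) _.
  by rewrite lerD // ler_wpM2l ?XB ?YB ?(sa_Lyy_ge0 sa) ?ltW ?(sa_Lyx_gt0 sa).
have : beta / 2 * enorm (y - y0) ^+ 2 <= bmax / 2 * B ^+ 2.
  by rewrite ler_pM ?enorm_sqr_le_diameter ?sqr_ge0 ?divr_ge0 // ler_pM2r.
have : 0 <= beta / 2 * enorm (ys - y0) ^+ 2 by rewrite mulr_ge0 ?sqr_ge0 ?divr_ge0.
lra.
Qed.

Section Step.
Variables (beta : R).
Hypotheses (beta0 : 0 <= beta) (sigma0 : 0 < mu + beta).
Let sigma := mu + beta.

(** Both maximizers are compared through the strong concavity of the two slices;
    the two payoff differences cancel up to the mixed Lipschitz constant. *)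
Lemma maximizer_lipschitz x x' ys ys' : X x -> X x' -> Y ys -> Y ys' ->
  (forall w, Y w -> Lr beta x w <= Lr beta x ys) ->
  (forall w, Y w -> Lr beta x' w <= Lr beta x' ys') ->
  enorm (ys' - ys) <= Lyx * enorm (x' - x) / sigma.
Proof.
move=> Xx Xx' Ys Ys' max max'.
have h1 := maximizer_growth cY (regularized_strongly_concave beta Xx) Ys max Ys'.
have h2 := maximizer_growth cY (regularized_strongly_concave beta Xx') Ys' max' Ys.
have := le_trans (ler_norm _) (payoff_mixed_lipschitz Xx Xx' Ys' Ys).
move: h1 h2; rewrite (enormB ys ys') -/sigma /Lr /regularized => h1 h2 h3.
rewrite ler_pdivlMr //.
have [->|r0] := eqVneq (enorm (ys' - ys)) 0.
  by rewrite mul0r mulr_ge0 ?enorm_ge0 // ltW // (sa_Lyx_gt0 sa).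
have {}r0 : 0 < enorm (ys' - ys) by rewrite lt0r r0 enorm_ge0.
rewrite -(ler_pM2l r0); lra.
Qed.

Lemma maximizer_distance x y ys : X x -> Y y -> Y ys ->
  F beta x = Lr beta x ys -> (forall w, Y w -> Lr beta x w <= Lr beta x ys) ->
  enorm (ys - y) <= Num.sqrt (2 * gap beta x y / sigma).
Proof.
move=> Xx Yy Ys FE max.
have := maximizer_growth cY (regularized_strongly_concave beta Xx) Ys max Yy.
rewrite gapE FE enormB -/sigma /Lr /regularized => h.
rewrite -(ger0_norm (enorm_ge0 _)) -sqrtr_sqr ler_wsqrtr // ler_pdivlMr //; lra.
Qed.

(** Through the maximizer at [x]: it moves by at most [Lyx rho / sigma], and the
    gap at [x] controls its distance to [y]. *)
Lemma next_maximizer_distance x x' y ys' (rho : R) : X x -> X x' -> Y y -> Y ys' ->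
  (forall w, Y w -> Lr beta x' w <= Lr beta x' ys') -> enorm (x' - x) <= rho ->
  enorm (ys' - y) <= Lyx * rho / sigma + Num.sqrt (2 * gap beta x y / sigma).
Proof.
move=> Xx Xx' Yy Ys' max' xrho; have [ys Ys [FE max]] := max_attained beta0 Xx.
rewrite -[ys' - y](subrKA ys); apply: le_trans (enormD _ _) _; apply: lerD.
  apply: le_trans (maximizer_lipschitz Xx Xx' Ys Ys' max max') _.
  by rewrite ler_pM2r ?invr_gt0 // ler_wpM2l // ltW // (sa_Lyx_gt0 sa).
exact: maximizer_distance.
Qed.

(** The old maximum is at least the payoff at the new maximizer [ys'], so the
    change of the gap is at most that of [L _ ys' - L _ y] between [x] and [x']. *)
Lemma gap_drift x x' y (rho : R) : X x -> X x' -> Y y -> enorm (x' - x) <= rho ->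
  gap beta x' y <= gap beta x y
    + Lyx * rho * (Lyx * rho / sigma + Num.sqrt (2 * gap beta x y / sigma)).
Proof.
move=> Xx Xx' Yy xrho; have [ys' Ys' [FE' max']] := max_attained beta0 Xx'.
have hd := next_maximizer_distance Xx Xx' Yy Ys' max' xrho.
have := le_trans (ler_norm _) (payoff_mixed_lipschitz Xx Xx' Ys' Yy).
have := primal_fun_ge beta0 Xx Ys'.
have : Lyx * enorm (ys' - y) * enorm (x' - x) <=
    Lyx * rho * (Lyx * rho / sigma + Num.sqrt (2 * gap beta x y / sigma)).
  set E := _ + Num.sqrt _ in hd *.
  rewrite mulrAC -!mulrA ler_pM2l ?(sa_Lyx_gt0 sa) //.
  by rewrite ler_pM ?enorm_ge0.
set A := Lyx * rho * _.
have := gapE beta x y; rewrite (gapE beta x' y) FE' /Lr /regularized; lra.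
Qed.

Hypothesis cvx : forall y, Y y -> convex_function X (L^~ y).

(** The smooth upper model is applied to the slice at the maximizer for the new
    point, which avoids differentiating the maximum.  Replacing the gradient at
    that maximizer by the one seen by the oracle costs [next_maximizer_distance],
    and convexity compares the oracle with an arbitrary competitor [z]. *)
Lemma primal_step x v y z (tau : R) : X x -> Y y -> X z -> 0 <= tau <= 1 ->
  is_lmo X (gradx L x y) v ->
  F beta (x + tau *: (v - x)) - F beta z <=
    (1 - tau) * (F beta x - F beta z)
    + tau * (gap beta x y + Lyx * B * (Lyx * (tau * B) / sigma
                                       + Num.sqrt (2 * gap beta x y / sigma)))
    + tau ^+ 2 * (Lxx / 2 * B ^+ 2).
Proof.
move=> Xx Yy Xz tau01 [Xv vle]; have [tau0 _] := andP tau01.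
set x' := x + _; have Xx' : X x' by apply: convex_setP.
have xrho : enorm (x' - x) <= tau * B.
  by rewrite /x' [x + _ - x]addrC addKr enormZ ger0_norm // ler_wpM2l // XB.
have [ys' Ys' [FE' max']] := max_attained beta0 Xx'.
have hd := next_maximizer_distance Xx Xx' Yy Ys' max' xrho.
have := smooth_le cX (smooth_x Ys') Xx Xv tau01.
have := convex_above_tangent cX (smooth_x Yy) (cvx Yy) Xx Xz.
have := vle _ Xz; rewrite -!/(gradx _ _ _) -/x' => h1 h2 h3.
have h4 : dot (gradx L x ys') (v - x) <= dot (gradx L x y) (v - x)
    + Lyx * B * (Lyx * (tau * B) / sigma + Num.sqrt (2 * gap beta x y / sigma)).
  set E := _ + Num.sqrt _ in hd *.
  rewrite -[gradx L x ys'](subrK (gradx L x y)) dotDl addrC lerD2l.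
  apply: le_trans (cauchy_schwarz _ _) _; rewrite -mulrA (mulrC B) mulrA.
  rewrite ler_pM ?enorm_ge0 ?XB //.
  apply: le_trans (sa_gradx_lipschitz sa Xx Ys' Xx Yy) _.
  by rewrite subrr enorm0 mulr0 add0r ler_pM2l // (sa_Lyx_gt0 sa).
have h5 : Lxx / 2 * enorm (v - x) ^+ 2 <= Lxx / 2 * B ^+ 2.
  rewrite ler_wpM2l ?divr_ge0 ?(sa_Lxx_ge0 sa) //.
  by rewrite lerXn2r ?nnegrE ?enorm_ge0 // ?(ltW B0) // XB.
have h6 := primal_fun_ge beta0 Xz Yy.
have h7 := primal_fun_ge beta0 Xx Ys'.
have h8 := ler_wpM2l (sqr_ge0 tau) h5.
have h10 : dot (gradx L x y) (v - x) <= dot (gradx L x y) (z - x).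
  by rewrite !dotDr lerD2r.
set E := Lyx * B * _ in h4 *.
have h9 : dot (gradx L x ys') (v - x) <= F beta z - F beta x + (gap beta x y + E).
  by rewrite gapE; move: h6; rewrite /Lr /regularized; lra.
have := ler_wpM2l tau0 h9; move: h3 h7; rewrite FE' /Lr /regularized; lra.
Qed.

End Step.
End Diameters.
End Regularized.
End Saddle.

(** * Polynomially decaying sequences *)

Section PolyDecay.
Context {R : realType}.
Implicit Types (a b : R) (t : nat).

Lemma poly_decay_gt0 a t : 0 < poly_decay a t.
Proof. by rewrite powR_gt0 // ltr0n. Qed.

Lemma poly_decay0 t : poly_decay (0 : R) t = 1.
Proof. by rewrite /poly_decay oppr0 powRr0. Qed.

Lemma poly_decay1 t : poly_decay (1 : R) t = t.+1%:R^-1.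
Proof. by rewrite /poly_decay powR_inv1 // ler0n. Qed.

Lemma poly_decayD a b t : poly_decay (a + b) t = poly_decay a t * poly_decay b t.
Proof. by rewrite /poly_decay opprD powRD // pnatr_eq0 implybT. Qed.

Lemma poly_decay_le a b t : a <= b -> poly_decay b t <= poly_decay a t.
Proof. by move=> ab; rewrite ler_powR ?ler1n // lerN2. Qed.

Lemma poly_decay_le1 a t : 0 <= a -> poly_decay a t <= 1.
Proof. by move=> a0; rewrite -(poly_decay0 t) poly_decay_le. Qed.

Let ratio t : R := t.+1%:R / t.+2%:R.

Let ratio01 t : 0 < ratio t <= 1.
Proof. by rewrite /ratio divr_gt0 ?ltr0n // ler_pdivrMr ?ltr0n // mul1r ler_nat leqnSn. Qed.

Let ratioE t : ratio t = 1 - t.+2%:R^-1.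
Proof.
by rewrite /ratio -[t.+1%:R](addrK 1) natr1 mulrBl divff ?pnatr_eq0 // mul1r.
Qed.

Lemma poly_decayS a t : poly_decay a t.+1 = poly_decay a t * ratio t `^ a.
Proof.
rewrite /poly_decay /ratio powRM ?ler0n ?invr_ge0 ?ler0n // mulrA.
rewrite -powRD ?pnatr_eq0 ?implybT //.
rewrite addNr powRr0 mul1r.
by rewrite -[t.+2%:R^-1]powR_inv1 ?ler0n // -powRrM mulN1r.
Qed.

Lemma poly_decayS_le a t : 0 <= a -> poly_decay a t.+1 <= poly_decay a t.
Proof.
move=> a0; rewrite poly_decayS ler_piMr ?(ltW (poly_decay_gt0 _ _)) //.
by have := ger_powR (ratio01 t) a0; rewrite powRr0.
Qed.

Lemma poly_decayS_ge a t : a <= 1 ->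
  poly_decay a t * (1 - t.+2%:R^-1) <= poly_decay a t.+1.
Proof.
move=> a1; rewrite poly_decayS ler_pM2l ?poly_decay_gt0 // -ratioE.
by rewrite ger1_powR.
Qed.

Lemma poly_decay_diff a t : a <= 1 ->
  poly_decay a t - poly_decay a t.+1 <= poly_decay (1 + a) t.
Proof.
move=> a1; have := poly_decayS_ge t a1; rewrite poly_decayD poly_decay1.
have : t.+2%:R^-1 <= t.+1%:R^-1 :> R by rewrite lef_pV2 ?posrE ?ltr0n // ler_nat leqnSn.
move=> /(ler_wpM2l (ltW (poly_decay_gt0 a t))).
move: (poly_decay a t) (poly_decay a t.+1) (t.+2%:R^-1) (t.+1%:R^-1) => P P2 i2 i1; lra.
Qed.

Lemma poly_decay_half a t : a <= 1 -> poly_decay a t <= 2 * poly_decay a t.+1.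
Proof.
move=> a1; have := poly_decayS_ge t a1.
have : t.+2%:R^-1 <= 2^-1 :> R by rewrite lef_pV2 ?posrE ?ltr0n // ler_nat.
move=> /(ler_wpM2l (ltW (poly_decay_gt0 a t))).
move: (poly_decay a t) (poly_decay a t.+1) (t.+2%:R^-1) => P P2 i2; lra.
Qed.

(** The increment of [n ^ (1 - a)] is at least [n ^ (-a) / 2].  With [rho] the ratio
    of consecutive bases, [rho ^ (1 - a) <= sqrt rho <= (1 + rho) / 2]. *)
Lemma poly_decay_increment a t : a <= 2^-1 ->
  t.+1%:R * poly_decay a t + poly_decay a t.+1 / 2 <= t.+2%:R * poly_decay a t.+1.
Proof.
move=> a2; have [r0 r1] := andP (ratio01 t).
have t2 : t.+2%:R != 0 :> R by rewrite pnatr_eq0.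
have t1E : t.+1%:R = t.+2%:R * ratio t :> R by rewrite /ratio mulrCA divff ?mulr1.
have rn0 : ratio t != 0 by rewrite gt_eqF.
have rE : ratio t = ratio t `^ a * ratio t `^ (1 - a).
  by rewrite -powRD ?rn0 ?implybT // subrKC powRr1 // ltW.
have hs : ratio t `^ (1 - a) <= (1 + ratio t) / 2.
  apply: (@le_trans _ _ (ratio t `^ 2^-1)).
    by apply: ger_powR => //; lra.
  rewrite powR12_sqrt ?(ltW r0) //; have := sqr_ge0 (1 - Num.sqrt (ratio t)).
  have := sqr_sqrtr (ltW r0); move: (ratio t) => z; move: (Num.sqrt z) => s.
lra.
have e2 : t.+2%:R * (1 - ratio t) = 1 by rewrite ratioE opprB addrC subrK divff.
rewrite t1E {1}rE poly_decayS; move: e2 hs.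
have PQ : 0 < poly_decay a t * ratio t `^ a.
  by rewrite mulr_gt0 ?poly_decay_gt0 // powR_gt0.
have := ler0n R t.+2; move: PQ.
move: (ratio t `^ (1 - a)) => S; move: (ratio t `^ a) => Q.
move: (poly_decay a t) (ratio t) (t.+2%:R : R) => P x n PQ n0 e2 hs.
have h1 : n * S + 2^-1 <= n by have := ler_wpM2l n0 hs; lra.
have := ler_wpM2l (ltW PQ) h1; lra.
Qed.

End PolyDecay.

Section Recursions.
Context {R : realType}.

(** If [h t] is below a quarter of the target, the error terms cannot lift it above
    the target, which itself shrinks by at most a factor two in one step.
    Otherwise the cubic decrease, with [l = k / 2], beats the error, linear in
    [k], and the decrease of the target, quadratic in [k].  All bounds are put on
    the scale [1 + q], and the target is parametrized as [k ^ 2] because the drift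
    involves the square root of [h]. *)
Lemma recursion_rate (h : nat -> R) (r q c A A' : R) :
  r <= 1 -> 0 <= q <= r -> 0 < c -> 0 <= A -> 0 <= A' ->
  (forall t k, 1 <= k -> h t <= k ^+ 2 * poly_decay r t ->
     h t.+1 <= h t + (A * k + A') * poly_decay (1 + q) t) ->
  (forall t k l, 1 <= k -> 1 <= l ->
     l ^+ 2 * poly_decay r t <= h t <= k ^+ 2 * poly_decay r t ->
     h t.+1 <= h t + (A * k + A' - c * l ^+ 3) * poly_decay (1 + q) t) ->
  exists2 k, 1 <= k & forall t, h t <= k ^+ 2 * poly_decay r t.
Proof.
move=> r1 /andP[q0 qr] c0 A0 A'0 hstep hdrop.
pose k := 2 + `|h 0| + 4 * (A + A') + 8 * (1 + A + A') / c.
have h8 : 0 <= 8 * (1 + A + A') / c by rewrite divr_ge0 ?(ltW c0) //; lra.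
have k2 : 2 <= k by have := normr_ge0 (h 0); rewrite /k; lra.
have kA : 4 * (A + A') <= k by have := normr_ge0 (h 0); rewrite /k; lra.
have kc : 8 * (1 + A + A') <= k * c.
  by rewrite -ler_pdivrMr //; have := normr_ge0 (h 0); rewrite /k; lra.
exists k; first lra.
elim=> [|t IH].
  rewrite /poly_decay powR1 mulr1 (le_trans (ler_norm _)) //.
  have : `|h 0| <= k by rewrite /k; lra.
  have : k * 1 <= k * k by rewrite ler_pM2l; lra.
  lra.
have k1 : 1 <= k by lra.
have l1 : 1 <= k / 2 by lra.
have Pr0 := poly_decay_gt0 r t; have Ps0 := poly_decay_gt0 (1 + q) t.
have AkA : A * k + A' <= (A + A') * k by rewrite mulrDl lerD2l ler_peMr.
have [hl|/ltW hl] := leP (h t) ((k / 2) ^+ 2 * poly_decay r t).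
  apply: le_trans (hstep t k k1 IH) _.
  have sr : poly_decay (1 + q) t <= poly_decay r t by apply: poly_decay_le; lra.
  have : (A * k + A') * poly_decay (1 + q) t <= k ^+ 2 / 4 * poly_decay r t.
    apply: ler_pM => //; [by rewrite addr_ge0 ?mulr_ge0 //; lra | exact: ltW |].
    apply: le_trans AkA _.
    have := ler_wpM2r (le_trans ler01 k1) kA; lra.
  have := ler_wpM2l (sqr_ge0 k) (poly_decay_half t r1).
  lra.
have hkl : (k / 2) ^+ 2 * poly_decay r t <= h t <= k ^+ 2 * poly_decay r t.
  by rewrite hl IH.
apply: le_trans (hdrop t k _ k1 l1 hkl) _.
have hs : poly_decay r t - poly_decay r t.+1 <= poly_decay (1 + q) t.
  by apply: le_trans (poly_decay_diff t r1) _; apply: poly_decay_le; lra.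
have h1 := ler_wpM2l (sqr_ge0 k) hs.
have h2 : k ^+ 2 + (A * k + A' - c * (k / 2) ^+ 3) <= 0.
  have h3 : A * k + A' <= (A + A') * k ^+ 2.
    apply: le_trans AkA _; rewrite ler_wpM2l ?addr_ge0 // expr2 ler_peMr //; lra.
  have := ler_wpM2r (sqr_ge0 k) kc; lra.
have := ler_wpM2r (ltW Ps0) h2; lra.
Qed.

(** Steps of length [1 / (t + 1)] make [t * p t] telescope.  The first step erases
    [p 0], so that the bound does not depend on it. *)
Lemma averaging_rate (p : nat -> R) (q E : R) : q <= 2^-1 -> 0 <= E ->
  (forall t, t.+1%:R * p t.+1 <= t%:R * p t + E * poly_decay q t) ->
  forall t, p t.+1 <= 2 * E * poly_decay q t.
Proof.
move=> q2 E0 step; elim=> [|t IH].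
  have := step 0%N; rewrite mul0r mul1r add0r /poly_decay powR1; lra.
have t2 : 0 < t.+2%:R :> R by rewrite ltr0n.
rewrite -(ler_pM2l t2); apply: le_trans (step t.+1) _.
have h1 := ler_wpM2l (ler0n R t.+1) IH.
have h2 := ler_wpM2l E0 (poly_decay_increment t q2); lra.
Qed.

End Recursions.

(** * Rates along a run *)

Section Run.
Context {R : realType} {dx dy : nat}.
Variables (X : set 'rV[R]_dx) (Y : set 'rV[R]_dy).
Variables (L : 'rV[R]_dx -> 'rV[R]_dy -> R) (mu Lxx Lyy Lyx : R).
Hypothesis sa : standing_assumption X Y L mu Lxx Lyy Lyx.
Hypothesis cvx : forall y, Y y -> convex_function X (L^~ y).
Variables (x : nat -> 'rV[R]_dx) (y : nat -> 'rV[R]_dy) (beta : nat -> R).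
Hypothesis run : lmo_lmo X Y L Lyy (poly_decay 1) beta x y.
Hypothesis beta_ge0 : forall t, 0 <= beta t.
Hypothesis beta_noninc : forall t, beta t.+1 <= beta t.
Hypothesis sigma_gt0 : forall t, 0 < mu + beta t.
Variable B : R.
Hypothesis B_gt0 : 0 < B.
Hypothesis XB : forall u v, X u -> X v -> enorm (u - v) <= B.
Hypothesis YB : forall u v, Y u -> Y v -> enorm (u - v) <= B.

Let Lr t := regularized L (y 0%N) (beta t).
Let F t := primal_fun Y (Lr t).
Let gap t := gap_dual Y (Lr t) (x t) (y t).
(* The gap between the two half steps: [y] is updated, [x] is not. *)
Let half_gap t := gap_dual Y (Lr t) (x t) (y t.+1).

Let M_ge0 t : 0 <= Lyy + beta t.
Proof. by rewrite addr_ge0 // (sa_Lyy_ge0 sa). Qed.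

Let tau01 t : 0 <= (poly_decay 1 t : R) <= 1.
Proof. by rewrite ltW ?poly_decay_gt0 // poly_decay_le1. Qed.

Lemma iterates_in t : X (x t) /\ Y (y t).
Proof.
have [X0 Y0 step] := run; elim: t => // t [Xt Yt].
have [v [u [[Xv _] -> ulmo ->]]] := step t; split.
  exact: convex_setP (sa_X_convex sa) Xt Xv (tau01 t).
exact: (short_step_in (sa_Y_convex sa)
  (regularized_smooth sa (y 0%N) (beta_ge0 t) Xt)
  (regularized_strongly_concave sa (y 0%N) (beta t) Xt)
  (sigma_gt0 t) (M_ge0 t) erefl Yt ulmo).
Qed.

Let Xx t : X (x t). Proof. by case: (iterates_in t). Qed.
Let Yy t : Y (y t). Proof. by case: (iterates_in t). Qed.

Let gap_run_ge0 t : 0 <= gap t.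
Proof. exact: (gap_ge0 sa (y 0%N) (beta_ge0 t) (Xx t) (Yy t)). Qed.

Lemma dual_progress_diameter (H : R) t : 0 < H -> gap t <= H ->
  half_gap t <= gap t - gap t ^+ 2 / (2 * (H + (Lyy + beta t) * B ^+ 2)).
Proof.
move=> H0 gH; have [_ _ step] := run; have [v [u [_ _ ulmo yE]]] := step t.
have [ys Ys [FE _]] := max_attained sa (y 0%N) (beta_ge0 t) (Xx t).
have gE : Lr t (x t) ys - Lr t (x t) (y t) = gap t.
  by rewrite -[gap t]/(F t (x t) - Lr t (x t) (y t)) /F FE.
have uB : enorm (u - y t) <= B by case: ulmo => Yu _; apply: YB.
have := progress_diameter (sa_Y_convex sa)
  (regularized_smooth sa (y 0%N) (beta_ge0 t) (Xx t))
  (regularized_strongly_concave sa (y 0%N) (beta t) (Xx t))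
  (sigma_gt0 t) (M_ge0 t) erefl (Yy t) ulmo Ys H0.
rewrite gE gap_run_ge0 gH => /(_ _ isT uB); rewrite -[y t + _]yE.
have hE : half_gap t = Lr t (x t) ys - Lr t (x t) (y t.+1).
  by rewrite -[half_gap t]/(F t (x t) - Lr t (x t) (y t.+1)) /F FE.
rewrite hE -gE /Lr; lra.
Qed.

Lemma dual_progress_strongly_convex_set (alpha W : R) t : 0 < alpha ->
  strongly_convex_set alpha Y -> 0 < W ->
  Num.sqrt (2 * (mu + beta t) * gap t) <= W ->
  half_gap t <= gap t - Num.sqrt (2 * (mu + beta t) * gap t) * gap t
                          / (2 * (W + 4 * (Lyy + beta t) / alpha)).
Proof.
move=> alpha0 Yalpha W0 gW; have [_ _ step] := run; have [v [u [_ _ ulmo yE]]] := step t.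
have [ys Ys [FE _]] := max_attained sa (y 0%N) (beta_ge0 t) (Xx t).
have gE : Lr t (x t) ys - Lr t (x t) (y t) = gap t.
  by rewrite -[gap t]/(F t (x t) - Lr t (x t) (y t)) /F FE.
have := progress_strongly_convex_set (sa_Y_convex sa)
  (regularized_smooth sa (y 0%N) (beta_ge0 t) (Xx t))
  (regularized_strongly_concave sa (y 0%N) (beta t) (Xx t))
  (sigma_gt0 t) (M_ge0 t) erefl (Yy t) ulmo Ys alpha0 Yalpha.
rewrite gE gap_run_ge0 => /(_ W isT W0 gW); rewrite -[y t + _]yE.
have hE : half_gap t = Lr t (x t) ys - Lr t (x t) (y t.+1).
  by rewrite -[half_gap t]/(F t (x t) - Lr t (x t) (y t.+1)) /F FE.
rewrite hE -gE /Lr; lra.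
Qed.

Let beta_le0 t : beta t <= beta 0%N.
Proof. by elim: t => // t; apply: le_trans. Qed.

Lemma gap_run_bounded : exists2 H : R, 0 < H & forall t, gap t <= H.
Proof.
have [H H0 gH] := gap_bounded sa (Yy 0%N) B_gt0 XB YB (beta_ge0 0%N).
by exists H => // t; apply: gH; rewrite ?beta_ge0 ?beta_le0.
Qed.

Lemma half_gap_le t : half_gap t <= gap t.
Proof.
have [H H0 gH] := gap_run_bounded; apply: le_trans (dual_progress_diameter H0 (gH t)) _.
rewrite gerBl divr_ge0 ?sqr_ge0 // mulr_ge0 // addr_ge0 ?(ltW H0) //.
by rewrite mulr_ge0 ?sqr_ge0 ?M_ge0.
Qed.

(** The exponents: [b] for the strong concavity modulus, [r] for the dual gap and
    [q] for the primal gap, linked by [q = (r - b) / 2]. *)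
Section Exponents.
Variables (r b q c0 C0 : R).
Hypotheses (b_ge0 : 0 <= b) (r_le1 : r <= 1) (q_ge0 : 0 <= q) (q_le : q <= 2^-1).
Hypotheses (qE : r = b + 2 * q) (qb : q <= 1 - b).
Hypothesis c0_gt0 : 0 < c0.
Hypothesis sigma_ge : forall t, c0 * poly_decay b t <= mu + beta t.
Hypothesis C0_ge0 : 0 <= C0.
Hypothesis beta_diff : forall t, beta t - beta t.+1 <= C0 * poly_decay (1 + q) t.

Let q_le_r : q <= r.
Proof. move: b_ge0 q_ge0; rewrite qE; lra. Qed.

Let q_le1 : q <= 1.
Proof. move: q_le; lra. Qed.

Let pd_gt0 := @poly_decay_gt0 R.

Let sqrt_ratio (g k : R) t : 0 <= k -> g <= k ^+ 2 * poly_decay r t ->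
  Num.sqrt (2 * g / (mu + beta t)) <= Num.sqrt (2 / c0) * k * poly_decay q t.
Proof.
move=> k0 gk.
have kq0 : 0 <= k * poly_decay q t by rewrite mulr_ge0 // ltW.
rewrite -[leRHS]mulrA -[k * _]ger0_norm // -sqrtr_sqr -sqrtrM ?divr_ge0 ?(ltW c0_gt0) //.
rewrite ler_wsqrtr // ler_pdivrMr //.
have -> : 2 / c0 * (k * poly_decay q t) ^+ 2 * (mu + beta t) =
   2 * (k ^+ 2 * poly_decay q t ^+ 2 * ((mu + beta t) / c0)).
  by rewrite exprMn; ring.
rewrite ler_pM2l // (le_trans gk) // -mulrA ler_wpM2l ?sqr_ge0 //.
have -> : poly_decay r t = poly_decay q t ^+ 2 * poly_decay b t.
  by rewrite expr2 -!poly_decayD qE; congr poly_decay; ring.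
by rewrite ler_wpM2l ?sqr_ge0 // ler_pdivlMr // mulrC.
Qed.

Let inv_sigma t : poly_decay 1 t / (mu + beta t) <= poly_decay q t / c0.
Proof.
rewrite ler_pdivrMr // mulrAC ler_pdivlMr // mulrC.
apply: (@le_trans _ _ (poly_decay q t * (c0 * poly_decay b t))).
  by rewrite mulrCA ler_pM2l // -poly_decayD poly_decay_le // -lerBrDr.
by rewrite ler_pM2l.
Qed.

Let S := Num.sqrt (2 / c0).

(** The decrease of the gap in the dual half step is kept abstract here, so that
    the two geometries of the dual set share the rest of the argument. *)
Lemma gap_rate :
  (exists2 c : R, 0 < c & forall t l, 1 <= l -> l ^+ 2 * poly_decay r t <= gap t ->
     half_gap t <= gap t - c * l ^+ 3 * poly_decay (1 + q) t) ->
  exists2 k : R, 1 <= k & forall t, gap t <= k ^+ 2 * poly_decay r t.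
Proof.
move=> [c c_gt0 drop]; have Lyx0 := sa_Lyx_gt0 sa.
have LB : 0 < Lyx * B by rewrite mulr_gt0.
have drift t (k : R) : 1 <= k -> gap t <= k ^+ 2 * poly_decay r t ->
  gap t.+1 <= half_gap t
    + (Lyx * B * S * k + ((Lyx * B) ^+ 2 / c0 + C0 / 2 * B ^+ 2)) * poly_decay (1 + q) t.
  move=> k1 gk; have k0 := le_trans ler01 k1.
  have bb : 0 <= beta t.+1 <= beta t by rewrite beta_ge0 beta_noninc.
  have h1 := gap_perturb sa (Yy 0%N) B_gt0 YB bb (Xx t.+1) (Yy t.+1).
  have xx : enorm (x t.+1 - x t) <= poly_decay 1 t * B.
    have [_ _ step] := run; have [v [u [[Xv _] -> _ _]]] := step t.
    rewrite [x t + _ - x t]addrC addKr enormZ.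
    by have [tau0 _] := andP (tau01 t); rewrite ger0_norm // ler_wpM2l // XB.
  have h2 := gap_drift sa (y 0%N) (beta_ge0 t) (sigma_gt0 t) (Xx t) (Xx t.+1) (Yy t.+1) xx.
  have h3 := sqrt_ratio k0 (le_trans (half_gap_le t) gk).
  have h4 := ler_wpM2r (sqr_ge0 B) (beta_diff t).
  have LBp : 0 <= Lyx * (poly_decay 1 t * B) by rewrite !mulr_ge0 ?ltW.
  have h5 : Lyx * (poly_decay 1 t * B) / (mu + beta t) <= Lyx * B / c0 * poly_decay q t.
    rewrite -!mulrA ler_pM2l // (mulrA _ B) (mulrC _ B) -mulrA ler_pM2l // [_^-1 * _]mulrC.
    exact: inv_sigma.
  have h6 := ler_wpM2l LBp (lerD h5 h3).
  rewrite -/(half_gap t) in h2; rewrite -/(gap t.+1) in h1.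
  have e : poly_decay (1 + q) t = poly_decay 1 t * poly_decay q t :> R by rewrite poly_decayD.
  rewrite e in h4 *.
  rewrite -/S in h6.
  move: h1 h2 h6; rewrite -/S.
  set w := Num.sqrt _; clearbody S; lra.
apply: (@recursion_rate _ gap r q c (Lyx * B * S)
  ((Lyx * B) ^+ 2 / c0 + C0 / 2 * B ^+ 2)) => //.
- by rewrite q_ge0 q_le_r.
- by rewrite mulr_ge0 ?sqrtr_ge0 // ltW.
- rewrite addr_ge0 ?divr_ge0 ?sqr_ge0 ?(ltW c0_gt0) //.
  by rewrite mulr_ge0 ?divr_ge0 ?sqr_ge0.
- by move=> t k k1 gk; apply: le_trans (drift t k k1 gk) _; rewrite lerD2r half_gap_le.
- move=> t k l k1 l1 /andP[lg gk]; have := drift t k k1 gk; have := drop t l l1 lg; lra.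
Qed.

Lemma primal_rate (k : R) : 1 <= k -> (forall t, gap t <= k ^+ 2 * poly_decay r t) ->
  exists2 E : R, 0 <= E & forall z t, X z ->
    F t.+1 (x t.+1) - F t.+1 z <= E * poly_decay q t.
Proof.
move=> k1 gk; have Lyx0 := sa_Lyx_gt0 sa; have k0 := le_trans ler01 k1.
have LB : 0 < Lyx * B by rewrite mulr_gt0.
pose E := k ^+ 2 + (Lyx * B) ^+ 2 / c0 + Lyx * B * S * k + Lxx / 2 * B ^+ 2 + C0 / 2 * B ^+ 2.
have e1 : 0 <= Lxx / 2 * B ^+ 2 by rewrite mulr_ge0 ?divr_ge0 ?sqr_ge0 ?(sa_Lxx_ge0 sa).
have E0 : 0 <= E.
  have e2 : 0 <= C0 / 2 * B ^+ 2 by rewrite mulr_ge0 ?divr_ge0 ?sqr_ge0.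
  have e3 : 0 <= Lyx * B * S * k by rewrite !mulr_ge0 ?sqrtr_ge0 ?(ltW B_gt0) ?(ltW Lyx0).
  have e4 : 0 <= (Lyx * B) ^+ 2 / c0 by rewrite divr_ge0 ?sqr_ge0 ?(ltW c0_gt0).
  by rewrite !addr_ge0 ?sqr_ge0.
exists (2 * E) => [|z t Xz]; first by rewrite mulr_ge0.
apply: (@averaging_rate _ (fun t => F t (x t) - F t z)) => // {}t.
have [_ _ step] := run; have [v [u [vlmo xE _ _]]] := step t.
have h1 := primal_step sa (y 0%N) B_gt0 XB (beta_ge0 t) (sigma_gt0 t) cvx
  (Xx t) (Yy t) Xz (tau01 t) vlmo.
rewrite -xE in h1.
have bb : 0 <= beta t.+1 <= beta t by rewrite beta_ge0 beta_noninc.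
have h2 := primal_fun_perturb sa (Yy 0%N) B_gt0 YB bb (Xx t.+1).
have h3 := primal_fun_antitone sa (y 0%N) bb Xz.
have h4 := sqrt_ratio k0 (gk t).
have h5 := ler_wpM2r (sqr_ge0 B) (beta_diff t).
have h6 : Lyx * (poly_decay 1 t * B) / (mu + beta t) <= Lyx * B / c0 * poly_decay q t.
  rewrite -!mulrA ler_pM2l // (mulrA _ B) (mulrC _ B) -mulrA ler_pM2l // [_^-1 * _]mulrC.
  exact: inv_sigma.
have h7 := ler_wpM2l (ltW LB) (lerD h6 h4).
have h8 : gap t <= k ^+ 2 * poly_decay q t.
  by apply: le_trans (gk t) _; rewrite ler_wpM2l ?sqr_ge0 // poly_decay_le.
have h9 : poly_decay 1 t * (Lxx / 2 * B ^+ 2) <= poly_decay q t * (Lxx / 2 * B ^+ 2).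
  by rewrite ler_wpM2r ?poly_decay_le.
have [P0 _] := andP (tau01 t).
have nP : t.+1%:R * poly_decay 1 t = 1 :> R by rewrite poly_decay1 divff // pnatr_eq0.
have h10 := ler_wpM2l P0 (lerD h8 h7); have h11 := ler_wpM2l P0 h9.
rewrite poly_decayD in h5.
have h12 : F t.+1 (x t.+1) - F t.+1 z <= (1 - poly_decay 1 t) * (F t (x t) - F t z)
    + poly_decay 1 t * (E * poly_decay q t).
  rewrite -/S in h10; move: h1 h2 h3 h5 h10 h11.
  rewrite -!/(Lr _) -!/(F _) -!/(gap _) /E.
  by set w := Num.sqrt _; clearbody S; lra.
have := ler_wpM2l (ler0n R t.+1) h12.
have -> (p Q : R) : t.+1%:R * ((1 - poly_decay 1 t) * p + poly_decay 1 t * Q)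
    = (t.+1%:R - t.+1%:R * poly_decay 1 t) * p + (t.+1%:R * poly_decay 1 t) * Q.
  by ring.
by rewrite nP -[in X in _ <= X -> _]natr1 addrK mul1r.
Qed.

(** The square of the gap is at least [l ^ 4 n ^ (-2 r)], and [3 r + b <= 2] makes
    [n ^ (-2 r)] dominate the drift.  The power [l ^ 4] is weakened to the [l ^ 3]
    available for strongly convex sets. *)
Lemma drop_diameter : 3 * r + b <= 2 ->
  exists2 c : R, 0 < c & forall t l, 1 <= l -> l ^+ 2 * poly_decay r t <= gap t ->
    half_gap t <= gap t - c * l ^+ 3 * poly_decay (1 + q) t.
Proof.
move=> rb; have [H H0 gH] := gap_run_bounded.
pose D := 2 * (H + (Lyy + beta 0%N) * B ^+ 2).
have D0 t : 0 < 2 * (H + (Lyy + beta t) * B ^+ 2).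
  by rewrite mulr_gt0 // ltr_wpDr // mulr_ge0 ?sqr_ge0.
have DD t : 2 * (H + (Lyy + beta t) * B ^+ 2) <= D.
  by rewrite ler_pM2l // lerD2l ler_wpM2r ?sqr_ge0 // lerD2l.
exists D^-1 => [|t l l1 lg]; first by rewrite invr_gt0 (lt_le_trans (D0 0%N)).
apply: le_trans (dual_progress_diameter H0 (gH t)) _; rewrite lerB //.
have l0 := le_trans ler01 l1.
rewrite -mulrA mulrC ler_pM ?mulr_ge0 ?exprn_ge0 ?invr_ge0 //.
- exact: ltW.
- exact: le_trans (ltW (D0 0%N)) (DD 0%N).
- apply: (@le_trans _ _ ((l ^+ 2 * poly_decay r t) ^+ 2)); last first.
    by rewrite lerXn2r ?nnegrE ?gap_run_ge0 ?mulr_ge0 ?sqr_ge0 // ltW.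
  rewrite exprMn -exprM ler_pM ?exprn_ge0 //; first exact: ltW.
    by rewrite ler_weXn2l.
  by rewrite expr2 -poly_decayD poly_decay_le //; move: rb; rewrite qE; lra.
- by rewrite lef_pV2 ?posrE // (lt_le_trans (D0 0%N)).
Qed.

(** The product [gap * sqrt (sigma gap)] is at least a multiple of
    [l ^ 3 n ^ (- (3 r + b) / 2)], and [r + b <= 1] makes this dominate the drift. *)
Lemma drop_strongly_convex_set (alpha : R) : r + b <= 1 -> 0 < alpha ->
  strongly_convex_set alpha Y ->
  exists2 c : R, 0 < c & forall t l, 1 <= l -> l ^+ 2 * poly_decay r t <= gap t ->
    half_gap t <= gap t - c * l ^+ 3 * poly_decay (1 + q) t.
Proof.
move=> rb alpha0 Yalpha; have [H H0 gH] := gap_run_bounded.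
pose W := Num.sqrt (2 * (mu + beta 0%N) * H).
have W0 : 0 < W by rewrite sqrtr_gt0 !mulr_gt0.
have gW t : Num.sqrt (2 * (mu + beta t) * gap t) <= W.
  rewrite ler_wsqrtr // ler_pM ?gap_run_ge0 //; first by rewrite mulr_ge0 // ltW.
  by rewrite ler_pM2l // lerD2l.
pose D := 2 * (W + 4 * (Lyy + beta 0%N) / alpha).
have D0 t : 0 < 2 * (W + 4 * (Lyy + beta t) / alpha).
  by rewrite mulr_gt0 // ltr_wpDr // divr_ge0 ?(ltW alpha0) // mulr_ge0.
have DD t : 2 * (W + 4 * (Lyy + beta t) / alpha) <= D.
  by rewrite ler_pM2l // lerD2l ler_pM2r ?invr_gt0 // ler_pM2l // lerD2l.
have s0 : 0 < Num.sqrt (2 * c0) by rewrite sqrtr_gt0 mulr_gt0.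
exists (Num.sqrt (2 * c0) / D) => [|t l l1 lg].
  by rewrite divr_gt0 // (lt_le_trans (D0 0%N)).
apply: le_trans (dual_progress_strongly_convex_set alpha0 Yalpha W0 (gW t)) _.
have l0 := le_trans ler01 l1.
set e := (b + r) / 2.
have root : Num.sqrt (2 * c0) * (l * poly_decay e t) <= Num.sqrt (2 * (mu + beta t) * gap t).
  rewrite -[l * _]ger0_norm ?mulr_ge0 ?(ltW (pd_gt0 _ _)) //.
  rewrite -sqrtr_sqr -sqrtrM ?mulr_ge0 ?(ltW c0_gt0) // ler_wsqrtr //.
  have -> : 2 * c0 * (l * poly_decay e t) ^+ 2 =
      2 * (c0 * poly_decay b t) * (l ^+ 2 * poly_decay r t).
    have ee : poly_decay e t ^+ 2 = poly_decay b t * poly_decay r t.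
      by rewrite expr2 -!poly_decayD; congr poly_decay; rewrite /e; field.
    by rewrite exprMn ee; ring.
  rewrite ler_pM ?mulr_ge0 ?sqr_ge0 ?(ltW c0_gt0) ?(ltW (pd_gt0 _ _)) //.
  by rewrite ler_pM2l.
rewrite lerB // -mulrA mulrAC ler_pM //.
- by rewrite !mulr_ge0 ?exprn_ge0 ?(ltW s0) ?(ltW (pd_gt0 _ _)).
- by rewrite invr_ge0 (le_trans (ltW (D0 0%N))).
- apply: (@le_trans _ _ (Num.sqrt (2 * c0) * (l * poly_decay e t)
      * (l ^+ 2 * poly_decay r t))).
    rewrite -mulrA ler_pM2l //.
    have -> : l * poly_decay e t * (l ^+ 2 * poly_decay r t) = l ^+ 3 * poly_decay (e + r) t.
      by rewrite poly_decayD; ring.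
    rewrite ler_wpM2l ?exprn_ge0 // poly_decay_le // /e; move: rb; rewrite qE; lra.
  rewrite ler_pM ?mulr_ge0 ?sqr_ge0 ?(ltW s0) ?(ltW (pd_gt0 _ _)) //.
- by rewrite lef_pV2 ?posrE // (lt_le_trans (D0 0%N)).
Qed.

(** Removing the regularization costs [beta B^2 / 2] in either gap.  The infimum
    over [X] is reached through the competitors [z], for which the constants of
    [primal_rate] are uniform. *)
Lemma rates :
  (exists2 c : R, 0 < c & forall t l, 1 <= l -> l ^+ 2 * poly_decay r t <= gap t ->
     half_gap t <= gap t - c * l ^+ 3 * poly_decay (1 + q) t) ->
  exists2 K : R, 0 < K & forall t,
    gap_opt X Y L (x t.+1) <= K * (poly_decay q t + beta t.+1) /\
    gap_dual Y L (x t.+1) (y t.+1) <= K * (poly_decay r t + beta t.+1).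
Proof.
move=> /gap_rate[k k1 gk]; have [E E0 pE] := primal_rate k1 gk.
have B2 := sqr_ge0 B; have k2 := sqr_ge0 k.
have b0 t : 0 <= (0 : R) <= beta t by rewrite lexx beta_ge0.
exists (1 + E + k ^+ 2 + B ^+ 2) => [|t]; first lra.
have Pr0 : 0 < poly_decay r t :> R by [].
have Pq0 : 0 < poly_decay q t :> R by [].
have bt := beta_ge0 t.+1; have := mulr_ge0 E0 bt; have := mulr_ge0 k2 bt.
have := mulr_ge0 B2 bt => Bb kb Eb.
split.
  have lower : primal_fun Y L (x t.+1) - (E * poly_decay q t + beta t.+1 / 2 * B ^+ 2)
      <= inf [set primal_fun Y L v | v in X].
    apply: lb_le_inf; first by have [v Xv] := sa_X_nonempty sa; exists (primal_fun Y L v), v.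
    move=> _ [z Xz <-]; have := pE z t Xz.
    have := primal_fun_antitone sa (y 0%N) (b0 t.+1) Xz.
    have := primal_fun_perturb sa (Yy 0%N) B_gt0 YB (b0 t.+1) (Xx t.+1).
    rewrite regularized0 subr0 /F /Lr; lra.
  have := mulr_ge0 k2 (ltW Pq0); have := mulr_ge0 B2 (ltW Pq0).
  move: lower; rewrite /gap_opt; lra.
have := gap_perturb sa (Yy 0%N) B_gt0 YB (b0 t.+1) (Xx t.+1) (Yy t.+1).
rewrite regularized0 subr0 -/(gap t.+1) => h.
have h1 : gap t.+1 <= k ^+ 2 * poly_decay r t.
  apply: le_trans (gk t.+1) _; rewrite ler_wpM2l // poly_decayS_le //.
  exact: le_trans q_ge0 q_le_r.
have := mulr_ge0 E0 (ltW Pr0); have := mulr_ge0 B2 (ltW Pr0); lra.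
Qed.

End Exponents.
End Run.

(** * Choice of the exponents *)

Section Cases.
Context {R : realType} {dx dy : nat}.
Variables (X : set 'rV[R]_dx) (Y : set 'rV[R]_dy).
Variables (L : 'rV[R]_dx -> 'rV[R]_dy -> R) (mu Lxx Lyy Lyx : R).
Hypothesis sa : standing_assumption X Y L mu Lxx Lyy Lyx.
Hypothesis cvx : forall y, Y y -> convex_function X (L^~ y).
Variables (x : nat -> 'rV[R]_dx) (y : nat -> 'rV[R]_dy).

Lemma common_diameter : exists2 B : R, 0 < B &
  (forall u v, X u -> X v -> enorm (u - v) <= B) /\
  (forall u v, Y u -> Y v -> enorm (u - v) <= B).
Proof.
have [BX BX0 XB] := compact_diameter (sa_X_compact sa).
have [BY BY0 YB] := compact_diameter (sa_Y_compact sa).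
exists (BX + BY); first exact: addr_gt0.
split=> u v uD vD.
  by rewrite (le_trans (XB _ _ uD vD)) // lerDl ltW.
by rewrite (le_trans (YB _ _ uD vD)) // lerDr ltW.
Qed.

Lemma bigO_poly_decay (g : nat -> R) (q K : R) : 0 < K ->
  (forall t, g t.+1 <= K * poly_decay q t) -> bigO_all g (fun T => T%:R `^ (- q)).
Proof. by move=> K0 h; exists K => // -[]. Qed.

(** The regularization error is of order [n ^ (-b)], and [r = 3 b] makes the primal
    rate [q] equal to [b] as well. *)
Lemma regularized_rates (C b r : R) :
  0 < C -> 0 <= b <= 3^-1 -> r = 3 * b ->
  3 * r + b <= 2 \/
    (r + b <= 1 /\ exists2 alpha : R, 0 < alpha & strongly_convex_set alpha Y) ->
  lmo_lmo X Y L Lyy (poly_decay 1) (fun t => C * poly_decay b t) x y ->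
  bigO_all (fun T => gap_opt X Y L (x T)) (fun T => T%:R `^ (- b)) /\
  bigO_all (fun T => gap_dual Y L (x T) (y T)) (fun T => T%:R `^ (- b)).
Proof.
move=> C0 /andP[b0 b3] rE cases run; have [B B0 [XB YB]] := common_diameter.
have beta0 t : 0 <= C * poly_decay b t.
  by rewrite mulr_ge0 ?(ltW C0) ?(ltW (poly_decay_gt0 _ _)).
have betaS t : C * poly_decay b t.+1 <= C * poly_decay b t.
  by rewrite ler_pM2l // poly_decayS_le.
have sigma t : C * poly_decay b t <= mu + C * poly_decay b t.
  by rewrite lerDr (sa_mu_ge0 sa).
have sigma0 t : 0 < mu + C * poly_decay b t.
  by apply: lt_le_trans (sigma t); rewrite mulr_gt0 ?poly_decay_gt0.
have diff t : C * poly_decay b t - C * poly_decay b t.+1 <= C * poly_decay (1 + b) t.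
  by rewrite -mulrBr ler_pM2l // poly_decay_diff //; lra.
have r1 : r <= 1 by lra.
have b2 : b <= 2^-1 by lra.
have rqE : r = b + 2 * b by lra.
have b1 : b <= 1 - b by lra.
have [|K K0 Krates] := rates sa cvx run beta0 betaS sigma0 B0 XB YB
  b0 r1 b0 b2 rqE b1 C0 sigma (ltW C0) diff.
  case: cases => [rb|[rb [alpha alpha0 Yalpha]]].
    exact: (drop_diameter sa run beta0 betaS sigma0 B0 XB YB rqE rb).
  exact: (drop_strongly_convex_set sa run beta0 betaS sigma0 B0 XB YB rqE
    C0 sigma rb alpha0 Yalpha).
have KC : 0 < K * (1 + C) by rewrite mulr_gt0 // addr_gt0.
have sum t (a : R) : b <= a ->
    K * (poly_decay a t + C * poly_decay b t.+1) <= K * (1 + C) * poly_decay b t.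
  move=> ba; rewrite -mulrA ler_pM2l // mulrDl mul1r lerD ?poly_decay_le //.
split; apply: (bigO_poly_decay KC) => t; have [Kopt Kdual] := Krates t.
  exact: le_trans Kopt (sum _ _ _).
apply: le_trans Kdual (sum _ _ _); lra.
Qed.

(** Without regularization the modulus is constant, that is [b = 0]; the power of
    the logarithm can be taken to be zero. *)
Lemma strongly_concave_rates (q r : R) :
  0 < mu -> 0 <= q <= 2^-1 -> r = 2 * q ->
  3 * r <= 2 \/ (r <= 1 /\ exists2 alpha : R, 0 < alpha & strongly_convex_set alpha Y) ->
  lmo_lmo X Y L Lyy (poly_decay 1) (fun=> 0) x y ->
  bigOtilde_all (fun T => gap_opt X Y L (x T)) (fun T => T%:R `^ (- q)) /\
  bigO_all (fun T => gap_dual Y L (x T) (y T)) (fun T => T%:R `^ (- r)).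
Proof.
move=> mu0 /andP[q0 q2] rE cases run.
have rqE : r = 0 + 2 * q by rewrite add0r.
have r1 : r <= 1 by lra.
have q1 : q <= 1 - 0 by lra.
have cases0 : 3 * r + 0 <= 2 \/
    (r + 0 <= 1 /\ exists2 alpha : R, 0 < alpha & strongly_convex_set alpha Y).
  by rewrite !addr0.
have [B B0 [XB YB]] := common_diameter.
have beta0 (t : nat) : 0 <= (0 : R) by [].
have sigma (t : nat) : mu * poly_decay 0 t <= mu + 0 by rewrite poly_decay0 mulr1 addr0.
have sigma0 (t : nat) : 0 < mu + 0 by rewrite addr0.
have diff t : (0 : R) - 0 <= 0 * poly_decay (1 + q) t by rewrite subr0 mul0r.
have [|K K0 Krates] := rates sa cvx run beta0 beta0 sigma0 B0 XB YB
  (lexx 0) r1 q0 q2 rqE q1 mu0 sigma (lexx _) diff.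
  case: cases0 => [rb|[rb [alpha alpha0 Yalpha]]].
    exact: (drop_diameter sa run beta0 beta0 sigma0 B0 XB YB rqE rb).
  exact: (drop_strongly_convex_set sa run beta0 beta0 sigma0 B0 XB YB rqE
    mu0 sigma rb alpha0 Yalpha).
split.
  exists 0%N; exists K => // -[//|t _]; rewrite expr0 mul1r.
  by have [] := Krates t; rewrite addr0.
by apply: (bigO_poly_decay K0) => t; have [_] := Krates t; rewrite addr0.
Qed.

End Cases.

Theorem theorem2p2 (R : realType) (dx dy : nat)
    (X : set 'rV[R]_dx) (Y : set 'rV[R]_dy)
    (L : 'rV[R]_dx -> 'rV[R]_dy -> R) (mu Lxx Lyy Lyx : R)
    (x : nat -> 'rV[R]_dx) (y : nat -> 'rV[R]_dy) :
  convex_concave X Y L ->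
  standing_assumption X Y L mu Lxx Lyy Lyx ->
  [/\ (* (i) *)
      forall C : R, 0 < C ->
        lmo_lmo X Y L Lyy (poly_decay 1)
          (fun t => C * poly_decay (1 / 5) t) x y ->
        bigO_all (fun T => gap_opt X Y L (x T))
                 (fun T => T%:R `^ (- (1 / 5))) /\
        bigO_all (fun T => gap_dual Y L (x T) (y T))
                 (fun T => T%:R `^ (- (1 / 5))),
      (* (ii) *)
      0 < mu ->
        lmo_lmo X Y L Lyy (poly_decay 1) (fun _ => 0) x y ->
        bigOtilde_all (fun T => gap_opt X Y L (x T))
                      (fun T => T%:R `^ (- (1 / 3))) /\
        bigO_all (fun T => gap_dual Y L (x T) (y T))
                 (fun T => T%:R `^ (- (2 / 3))),
      (* (iii) *)
      forall alpha C : R, 0 < alpha -> strongly_convex_set alpha Y -> 0 < C ->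
        lmo_lmo X Y L Lyy (poly_decay 1)
          (fun t => C * poly_decay (1 / 4) t) x y ->
        bigO_all (fun T => gap_opt X Y L (x T))
                 (fun T => T%:R `^ (- (1 / 4))) /\
        bigO_all (fun T => gap_dual Y L (x T) (y T))
                 (fun T => T%:R `^ (- (1 / 4))) &
      (* (iv) *)
      forall alpha : R, 0 < mu -> 0 < alpha -> strongly_convex_set alpha Y ->
        lmo_lmo X Y L Lyy (poly_decay 1) (fun _ => 0) x y ->
        bigOtilde_all (fun T => gap_opt X Y L (x T))
                      (fun T => T%:R `^ (- (1 / 2))) /\
        bigO_all (fun T => gap_dual Y L (x T) (y T))
                 (fun T => T%:R `^ (- 1))].
Proof.
move=> [cvx _] sa; split=> [C C0 run|mu0 run
  |alpha C alpha0 Yalpha C0 run|alpha mu0 alpha0 Yalpha run].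
- apply: (regularized_rates (r := 3 / 5) sa cvx C0 _ _ _ run);
    [lra | by field | left; lra].
- apply: (strongly_concave_rates sa cvx mu0 _ _ _ run); [lra | by field | left; lra].
- apply: (regularized_rates (r := 3 / 4) sa cvx C0 _ _ _ run);
    [lra | by field | right].
  by split; [lra | exists alpha].
- apply: (strongly_concave_rates sa cvx mu0 _ _ _ run); [lra | by field | right].
  by split; [lra | exists alpha].
Qed.
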